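(* For any $n,k\in\mathbb{N}$ satisfying $n>5000(k+1)$ and any $w:E(K_n)\to\mathbb{Z}$, one can find in time $O(n^7)$ either (a) a Hamilton cycle $H^*$ of $K_n$ satisfying $w(H^* )<dn-k$, or (b) a weighting $w^*:E(K_n)\to\mathbb{Z}$ and an integer $\alpha\in\mathbb{Z}$ such that $w^*(H)=w(H)+\alpha$ for every Hamilton cycle $H$ of $K_n$ and $w^*[K_n]\le 4000kn$.
   Context: $K_n$ is the complete graph on $n$ vertices. For a subgraph $G$ of $K_n$ and a weighting $u:E(K_n)\to\mathbb{Z}$, $u(G):=\sum_{e\in E(G)}u(e)$ and $u[G]:=\sum_{e\in E(G)}|u(e)|$. The density of $w$ is $d:=w(K_n)/\binom{n}{2}$. Running times are in the strong sense (arithmetic operations take time $O(1)$). *)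

(* Defs.v *)
From HB Require Import structures.
From mathcomp Require Import all_boot all_order all_algebra.

Set Implicit Arguments.
Unset Strict Implicit.
Unset Printing Implicit Defensive.

Import Order.TTheory GRing.Theory Num.Theory.
Local Open Scope ring_scope.

(** * Weighted complete graphs *)

Definition edge (n : nat) : Type := {e : {set 'I_n} | #|e| == 2%N}.

(* A subgraph enters only through its edge set, as all weights are sums over
   edges and Hamilton cycles are spanning. *)
Notation subgraph n := {set edge n}.

Definition weighting (n : nat) : Type := edge n -> int.

Definition complete (n : nat) : subgraph n := [set: edge n].

Definition weight (n : nat) (u : weighting n) (G : subgraph n) : int :=
  \sum_(e in G) u e.

Definition abs_weight (n : nat) (u : weighting n) (G : subgraph n) : int :=
  \sum_(e in G) `|u e|.

Definition density (n : nat) (w : weighting n) : rat :=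
  (weight w (complete n))%:~R / 'C(n, 2)%:R.

Definition cycle_edges (n : nat) (p : seq 'I_n) : subgraph n :=
  [set e | [exists x in p, val e == [set x; next p x]]].

(* [H] is the cycle that visits every vertex once, in the cyclic order [p]. *)
Definition traverses (n : nat) (p : seq 'I_n) (H : subgraph n) : Prop :=
  [/\ (2 < n)%N, uniq p, size p = n & H = cycle_edges p].

Definition hamilton_cycle (n : nat) (H : subgraph n) : Prop :=
  exists p : seq 'I_n, traverses p H.

(** * Random access machines with unit-cost integer arithmetic

    Programs are while-programs over countably many integer arrays, indexed by
    integers. A program is a fixed finite object that mentions finitely many
    arrays, so interleaving these in one memory turns it into an ordinary RAM
    program at the price of a constant factor in the running time. Every constant,
    memory access, arithmetic operation, assignment and test takes one step,
    whatever the size of the integers involved. *)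

Definition memory : Type := nat -> int -> int.

Definition update (m : memory) (x : nat) (i v : int) : memory :=
  fun y j => if (y == x) && (j == i) then v else m y j.

Inductive binop := Add | Sub | Mul | Div | Leq.

(* [Div] is Euclidean division, with value 0 when the divisor is 0. *)
Definition eval_op (o : binop) (a b : int) : int :=
  match o with
  | Add => a + b
  | Sub => a - b
  | Mul => a * b
  | Div => (a %/ b)%Z
  | Leq => if a <= b then 1 else 0
  end.

Inductive expr :=
| Const of int
| Read of nat & expr
| Op of binop & expr & expr.

Fixpoint eval (m : memory) (e : expr) : int :=
  match e with
  | Const c => c
  | Read x i => m x (eval m i)
  | Op o e1 e2 => eval_op o (eval m e1) (eval m e2)
  end.

Fixpoint expr_time (e : expr) : nat :=
  match e with
  | Const _ => 1
  | Read _ i => (expr_time i).+1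
  | Op _ e1 e2 => (expr_time e1 + expr_time e2).+1
  end.

Inductive program :=
| Skip
| Write of nat & expr & expr
| Seq of program & program
| If of expr & program & program
| While of expr & program.

(* [exec P m t m']: started in memory [m], the program [P] halts after exactly
   [t] steps in memory [m']. *)
Inductive exec : program -> memory -> nat -> memory -> Prop :=
| exec_skip m : exec Skip m 1%N m
| exec_write m x i e :
    exec (Write x i e) m (expr_time i + expr_time e).+1
      (update m x (eval m i) (eval m e))
| exec_seq m1 m2 m3 P Q t u :
    exec P m1 t m2 -> exec Q m2 u m3 -> exec (Seq P Q) m1 (t + u) m3
| exec_if_true m m' e P Q t :
    eval m e != 0 -> exec P m t m' ->
    exec (If e P Q) m (expr_time e + t).+1 m'
| exec_if_false m m' e P Q t :
    eval m e = 0 -> exec Q m t m' ->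
    exec (If e P Q) m (expr_time e + t).+1 m'
| exec_while_true m1 m2 m3 e P t u :
    eval m1 e != 0 -> exec P m1 t m2 -> exec (While e P) m2 u m3 ->
    exec (While e P) m1 (expr_time e + t + u).+1 m3
| exec_while_false m e P :
    eval m e = 0 -> exec (While e P) m (expr_time e).+1 m.

(** * Input and output conventions *)

(* The entry [i, j] of the symmetric matrix of [u]; zero on the diagonal, where
   [[set i; j]] is not an edge. *)
Definition entry (n : nat) (u : weighting n) (i j : 'I_n) : int :=
  oapp u 0 (insub [set i; j]).

(* The matrix of [u] in row-major order, followed and preceded by zeros. *)
Definition table (n : nat) (u : weighting n) (a : int) : int :=
  match a with
  | Posz c =>
      match insub (c %/ n)%N, insub (c %% n)%N with
      | Some i, Some j => entry u i j
      | _, _ => 0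
      end
  | Negz _ => 0
  end.

(* Array 0 holds [n], array 1 holds [k], array 2 holds the weights, and every
   other cell is zero. *)
Definition input (n k : nat) (w : weighting n) : memory :=
  fun x a =>
    match x with
    | 0 => if a == 0 then n%:Z else 0
    | 1 => if a == 0 then k%:Z else 0
    | 2 => table w a
    | _ => 0
    end.

Definition out_tag (m : memory) : int := m 3%N 0.

Definition outputs_cycle (n : nat) (m : memory) (H : subgraph n) : Prop :=
  exists2 p : seq 'I_n, traverses p H &
    forall i : nat, (i < n)%N -> m 4%N i%:Z = (nth 0%N (map val p) i)%:Z.

Definition outputs_weighting (n : nat) (m : memory) (u : weighting n) : Prop :=
  forall i j : 'I_n, i != j -> m 4%N (i * n + j)%N%:Z = entry u i j.

Definition outputs_integer (m : memory) (alpha : int) : Prop := m 5%N 0 = alpha.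

(* Main.v *)
Require Import Defs.
From mathcomp Require Import all_boot all_order all_algebra.
From mathcomp Require Import zify ring lra.

Set Implicit Arguments.
Unset Strict Implicit.
Unset Printing Implicit Defensive.

Import Order.TTheory GRing.Theory Num.Theory.
Local Open Scope ring_scope.

(* Fix vertices x, y, z. Subtracting from w the potential given by the star of x, and
   correcting by the constant c = w(xy) + w(xz) - w(yz), produces
   w*(uv) = w(uv) - w(xu) - w(xv) + c off x and 0 at x, which shifts all Hamilton
   cycles by the same amount. If some triple has w*[K_n] <= 4000kn, this is (b).
   Otherwise, each value of w* being a sum of at most two alternating 4-cycles
   Delta(a,b,c,d) = w(ab) + w(cd) - w(ac) - w(bd), averaging over the triples shows that
   |Delta| averages to more than about 4000k/n over all quadruples. Take a uniformly random
   cyclic order, cut it into blocks of three positions, and exchange the second and the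
   third vertex of a block a, b, c (followed by d) whenever Delta > 0. The exchanges are
   independent of each other, and each gains |Delta|/2 on average, so the expected
   weight of the tour is below dn - k with much room. Conditional expectations make
   this deterministic: the order is chosen vertex by vertex, and for each of the n
   steps and n candidates the conditional expectation is a sum over n windows of four
   consecutive positions of a sum over n^4 quadruples, hence the time O(n^7).
   Multiplying expectations by the factorial of the number of unplaced vertices keeps
   everything integral. *)

(** * Compiling terms with bounded folds *)

(* Parametric higher-order syntax: [V := nat] (levels of registers) is compiled,
   [V := int] is evaluated. [TFold g e f] iterates [f index accumulator] from [e],
   [n ^ g] times. *)
Inductive term (V : Type) :=
| TConst of int
| TVar of V
| TRead of nat & term V
| TOp of binop & term V & term V
| TFold of nat & term V & (V -> V -> term V).

Inductive stmt (V : Type) :=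
| SSet of nat & term V & term V
| SSeq of stmt V & stmt V
| SIf of term V & stmt V & stmt V
| SFor of nat & (V -> stmt V).

Arguments TConst {V}.

Fixpoint teval (n : nat) (A : memory) (e : term int) : int :=
  match e with
  | TConst c => c
  | TVar v => v
  | TRead a e => A a (teval n A e)
  | TOp o e1 e2 => eval_op o (teval n A e1) (teval n A e2)
  | TFold g e f =>
      iteri (n ^ g) (fun i acc => teval n A (f i%:Z acc)) (teval n A e)
  end.

Fixpoint srun (n : nat) (s : stmt int) (A : memory) : memory :=
  match s with
  | SSet a i e => update A a (teval n A i) (teval n A e)
  | SSeq s1 s2 => srun n s2 (srun n s1 A)
  | SIf e s1 s2 => if teval n A e != 0 then srun n s1 A else srun n s2 A
  | SFor g f => iteri (n ^ g) (fun i => srun n (f i%:Z)) A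
  end.

(* Arrays below [base] are the data of the algorithm; cell 0 of array
   [base + l] is the register of level [l]. *)
Definition base : nat := 9.

Definition reg (l : nat) : expr := Read (base + l) (Const 0).

Definition set_reg (l : nat) (e : expr) : program := Write (base + l) (Const 0) e.

(** The power n^g as a product of reads of the cell that holds n. Every loop test computes it anew,
    hence the summands in [g] in the cost of loops. *)
Definition bound_expr (g : nat) : expr :=
  iter g (Op Mul (Read 0 (Const 0))) (Const 1).

Definition loop_cond (l g : nat) : expr :=
  Op Leq (Op Add (reg l) (Const 1)) (bound_expr g).

Definition for_loop (l g : nat) (P : program) : program :=
  Seq (set_reg l (Const 0))
    (While (loop_cond l g)
       (Seq P (set_reg l (Op Add (reg l) (Const 1))))).

(** Stack discipline: code compiled at depth [d] leaves its value in register [d] and writes only to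
    registers of level at least [d]. A fold keeps its accumulator in register [d] and its index in
    [d.+1], and runs its body at depth [d.+2]. *)
Fixpoint tcomp (d : nat) (e : term nat) : program :=
  match e with
  | TConst c => set_reg d (Const c)
  | TVar l => set_reg d (reg l)
  | TRead a e => Seq (tcomp d e) (set_reg d (Read a (reg d)))
  | TOp o e1 e2 =>
      Seq (tcomp d e1) (Seq (tcomp d.+1 e2) (set_reg d (Op o (reg d) (reg d.+1))))
  | TFold g e f =>
      Seq (tcomp d e)
        (for_loop d.+1 g (Seq (tcomp d.+2 (f d.+1 d)) (set_reg d (reg d.+2))))
  end.

Fixpoint scomp (d : nat) (s : stmt nat) : program :=
  match s with
  | SSet a i e =>
      Seq (tcomp d i) (Seq (tcomp d.+1 e) (Write a (reg d) (reg d.+1)))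
  | SSeq s1 s2 => Seq (scomp d s1) (scomp d s2)
  | SIf e s1 s2 => Seq (tcomp d e) (If (reg d) (scomp d s1) (scomp d s2))
  | SFor g f => for_loop d g (scomp d.+1 (f d))
  end.

(* [term_rel G c g e e']: [e] and [e'] are two instances of one parametric term,
   with free variables related by [G], whose evaluation takes time at most
   [c * n ^ g]. *)
Inductive term_rel : seq (nat * int) -> nat -> nat -> term nat -> term int -> Prop :=
| rel_const G z : term_rel G 3 0 (TConst z) (TConst z)
| rel_var G l v : List.In (l, v) G -> term_rel G 4 0 (TVar l) (TVar v)
| rel_read G c g a e e' : (a < base)%N -> term_rel G c g e e' ->
    term_rel G (c + 5) g (TRead a e) (TRead a e')
| rel_op G c1 g1 c2 g2 o e1 e1' e2 e2' :
    term_rel G c1 g1 e1 e1' -> term_rel G c2 g2 e2 e2' ->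
    term_rel G (c1 + c2 + 7) (maxn g1 g2) (TOp o e1 e2) (TOp o e1' e2')
| rel_fold G c1 g1 c2 g2 g e e' f f' :
    term_rel G c1 g1 e e' ->
    (forall i x acc y,
      term_rel [:: (i, x), (acc, y) & G] c2 g2 (f i acc) (f' x y)) ->
    term_rel G (c1 + c2 + (31 + 6 * g)) (maxn g1 (g + g2))
      (TFold g e f) (TFold g e' f').

(** To be read like [term_rel]. The condition [0 < a < base] protects the size n in array 0 and the
    registers; a conditional is charged for both branches. *)
Inductive stmt_rel : seq (nat * int) -> nat -> nat -> stmt nat -> stmt int -> Prop :=
| rel_set G c1 g1 c2 g2 a i i' e e' : (0 < a < base)%N ->
    term_rel G c1 g1 i i' -> term_rel G c2 g2 e e' ->
    stmt_rel G (c1 + c2 + 5) (maxn g1 g2) (SSet a i e) (SSet a i' e')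
| rel_seq G c1 g1 c2 g2 s1 s1' s2 s2' :
    stmt_rel G c1 g1 s1 s1' -> stmt_rel G c2 g2 s2 s2' ->
    stmt_rel G (c1 + c2) (maxn g1 g2) (SSeq s1 s2) (SSeq s1' s2')
| rel_if G c0 g0 c1 g1 c2 g2 e e' s1 s1' s2 s2' :
    term_rel G c0 g0 e e' ->
    stmt_rel G c1 g1 s1 s1' -> stmt_rel G c2 g2 s2 s2' ->
    stmt_rel G (c0 + c1 + c2 + 3) (maxn g0 (maxn g1 g2))
      (SIf e s1 s2) (SIf e' s1' s2')
| rel_for G c g h f f' :
    (forall i x, stmt_rel ((i, x) :: G) c g (f i) (f' x)) ->
    stmt_rel G (c + (26 + 6 * h)) (h + g) (SFor h f) (SFor h f').

(** * Correctness and running time of compiled code *)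

Definition env_ok (G : seq (nat * int)) (d : nat) (m : memory) : Prop :=
  forall l v, List.In (l, v) G -> (l < d)%N /\ m (base + l)%N 0 = v.

Definition agree (b : nat) (m m' : memory) : Prop :=
  forall a i, (a < b)%N -> m a i = m' a i.

Lemma agree_trans b m1 m2 m3 : agree b m1 m2 -> agree b m2 m3 -> agree b m1 m3.
Proof. by move=> h1 h2 a i ha; rewrite h1 ?h2. Qed.

Lemma agree_leq b b' m m' : (b' <= b)%N -> agree b m m' -> agree b' m m'.
Proof. by move=> hb h a i ha; apply: h; apply: leq_trans hb. Qed.

Lemma agree_update b m a i v : (b <= a)%N -> agree b (update m a i v) m.
Proof. by move=> hb x j hx; rewrite /update; case: eqP => // ex; lia. Qed.

Lemma env_ok_agree G d m m' :
  agree (base + d) m' m -> env_ok G d m -> env_ok G d m'.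
Proof. by move=> h hG l v /hG [hl <-]; split=> //; apply: h; rewrite ltn_add2l. Qed.

Lemma env_ok_leq G d d' m : (d <= d')%N -> env_ok G d m -> env_ok G d' m.
Proof. by move=> hd hG l v /hG [hl <-]; split=> //; apply: leq_trans hd. Qed.

Definition runs (P : program) (m : memory) (T : nat) (Q : memory -> Prop) : Prop :=
  exists t m', [/\ exec P m t m', (t <= T)%N & Q m'].

Lemma runs_weaken P m T T' (Q Q' : memory -> Prop) :
  runs P m T Q -> (T <= T')%N -> (forall m', Q m' -> Q' m') -> runs P m T' Q'.
Proof.
move=> [t [m' [h1 h2 h3]]] hT hQ; exists t, m'; split=> //; last exact: hQ.
exact: leq_trans hT.
Qed.

Lemma runs_leq P m T T' (Q : memory -> Prop) :
  (T <= T')%N -> runs P m T Q -> runs P m T' Q.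
Proof. by move=> hT h; apply: runs_weaken h hT _. Qed.

Lemma runs_seq P1 P2 m T1 T2 (Q Q' : memory -> Prop) :
  runs P1 m T1 Q -> (forall m', Q m' -> runs P2 m' T2 Q') ->
  runs (Seq P1 P2) m (T1 + T2) Q'.
Proof.
move=> [t [m' [h1 h2 h3]]] /(_ _ h3) [t' [m'' [h4 h5 h6]]].
by exists (t + t')%N, m''; split=> //; [exact: exec_seq h1 h4 | exact: leq_add].
Qed.

Lemma runs_write a i e m :
  runs (Write a i e) m (expr_time i + expr_time e).+1
    (fun m' => m' = update m a (eval m i) (eval m e)).
Proof. by do 2!eexists; split; [exact: exec_write | |]. Qed.

Lemma eval_bound (m : memory) (n : nat) g : m 0%N 0 = n%:Z -> eval m (bound_expr g) = (n ^ g)%N%:Z.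
Proof. by move=> h; elim: g => //= g ->; rewrite h expnS PoszM. Qed.

Lemma bound_time g : expr_time (bound_expr g) = (1 + 3 * g)%N.
Proof. by elim: g => //= g ->; lia. Qed.

(** Each [I i] is stated for the memory whose index register is already [i]. A round costs [T] for
    the body, [6 + 3 * g] for the test, 6 for the increment and 1 for the loop, within the allowed
    [T + (14 + 3 * g)]. *)
Lemma runs_for l g P (m : memory) T (n : nat) (I : nat -> memory -> Prop) :
  m 0%N 0 = n%:Z ->
  I 0%N (update m (base + l) 0 0) ->
  (forall i (m' : memory), (i < n ^ g)%N -> m' 0%N 0 = n%:Z -> m' (base + l)%N 0 = i%:Z ->
     I i m' ->
     runs P m' T (fun m'' => [/\ m'' 0%N 0 = n%:Z, m'' (base + l)%N 0 = i%:Z &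
                     I i.+1 (update m'' (base + l) 0 i.+1%:Z)])) ->
  runs (for_loop l g P) m (n ^ g * (T + (14 + 3 * g)) + (12 + 3 * g)) (I (n ^ g)%N).
Proof.
move=> h0 hI step.
set e := loop_cond l g.
have te : expr_time e = (6 + 3 * g)%N by rewrite /e /= bound_time; lia.
(* Induction on the number [k] of rounds still to run. *)
have loop : forall k i (m' : memory), (i + k = n ^ g)%N -> m' 0%N 0 = n%:Z ->
    m' (base + l)%N 0 = i%:Z -> I i m' ->
    runs (While e (Seq P (set_reg l (Op Add (reg l) (Const 1))))) m'
      (k * (T + (14 + 3 * g)) + (7 + 3 * g)) (I (n ^ g)%N).
  elim=> [|k IH] i m' hi h0' hl hIi.
    exists (expr_time e).+1, m'; split; last by rewrite -hi addn0.
      by apply: exec_while_false; rewrite /e /= hl (eval_bound g h0'); case: ifP => //; lia.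
    by rewrite te mul0n; lia.
  have hlt : (i < n ^ g)%N by lia.
  have [t [m1 [ex1 ht [h01 hl1 hI1]]]] := step i m' hlt h0' hl hIi.
  set m2 := update m1 (base + l) 0 i.+1%:Z.
  have ex2 : exec (set_reg l (Op Add (reg l) (Const 1))) m1 6 m2.
    have := exec_write m1 (base + l) (Const 0) (Op Add (reg l) (Const 1)).
    by rewrite /= hl1 -PoszD (addn1 i).
  have h02 : m2 0%N 0 = n%:Z by rewrite /m2 /update.
  have hl2 : m2 (base + l)%N 0 = i.+1%:Z by rewrite /m2 /update !eqxx.
  have [t' [m3 [ex3 ht' hI3]]] := IH i.+1 m2 ltac:(lia) h02 hl2 hI1.
  exists (expr_time e + (t + 6) + t').+1, m3; split=> //; last by rewrite te; lia.
  apply: exec_while_true (exec_seq ex1 ex2) ex3.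
  by rewrite /e /= hl (eval_bound g h0'); case: ifP => //; lia.
apply: (@runs_leq _ _ (3 + (n ^ g * (T + (14 + 3 * g)) + (7 + 3 * g)))); first by lia.
apply: runs_seq (runs_write _ _ _ _) _ => m' -> /=.
by apply: (loop _ 0%N); rewrite ?add0n // /update ?eqxx.
Qed.

Lemma leq_mulexp c n g g' : (0 < n)%N -> (g <= g')%N -> (c * n ^ g <= c * n ^ g')%N.
Proof. by move=> hn hg; rewrite leq_mul2l leq_pexp2l ?orbT. Qed.

Lemma leq_exp1 c n g : (0 < n)%N -> (c <= c * n ^ g)%N.
Proof. by move=> hn; rewrite leq_pmulr // expn_gt0 hn. Qed.

Lemma tcomp_correct n (A : memory) G c g e e' : (0 < n)%N -> A 0%N 0 = n%:Z ->
  term_rel G c g e e' ->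
  forall d m, agree base m A -> env_ok G d m ->
  runs (tcomp d e) m (c * n ^ g)
    (fun m' => agree (base + d) m' m /\ m' (base + d)%N 0 = teval n A e').
Proof.
move=> hn hA; elim=> {G c g e e'}
  [G z|G l v hin|G c g a e e' ha _ IH|G c1 g1 c2 g2 o e1 e1' e2 e2' _ IH1 _ IH2
  |G c1 g1 c2 g2 g e e' f f' _ IH1 _ IH2] d m hm hG.
- apply: runs_weaken (runs_write _ _ _ _) _ _ => //= m' ->.
  by split; [apply: agree_update | rewrite /update !eqxx].
- apply: runs_weaken (runs_write _ _ _ _) _ _ => //= m' ->.
  by split; [apply: agree_update | rewrite /update !eqxx /=; have [] := hG _ _ hin].
- apply: (@runs_leq _ _ (c * n ^ g + 5)); last first.
    apply: (runs_seq (IH d m hm hG)) => m1 [hm1 hv].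
    apply: runs_weaken (runs_write _ _ _ _) _ _ => //= m' ->.
    split; first by apply: agree_trans hm1; apply: agree_update.
    rewrite /update !eqxx /= hv hm1 ?hm //; exact: leq_trans ha (leq_addr _ _).
  by rewrite mulnDl leq_add2l leq_exp1.
- apply: (@runs_leq _ _ (c1 * n ^ g1 + (c2 * n ^ g2 + 7))); last first.
    apply: (runs_seq (IH1 d m hm hG)) => m1 [hm1 hv1].
    have hm1' : agree base m1 m by apply: agree_leq hm1; rewrite leq_addr.
    apply: (runs_seq (IH2 d.+1 m1 _ _)) => [||m2 [hm2 hv2]].
    + exact: agree_trans hm1' hm.
    + exact: env_ok_leq (leqnSn d) (env_ok_agree hm1 hG).
    apply: runs_weaken (runs_write _ _ _ _) _ _ => //= m' ->.
    split.
      apply: (agree_trans (agree_update _ _ _ _)) => //; apply: agree_trans hm1.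
      by apply: agree_leq hm2; lia.
    by rewrite /update !eqxx /= hv2 (hm2 (base + d)%N) ?hv1 //; lia.
  have := @leq_mulexp c1 _ _ _ hn (leq_maxl g1 g2).
  have := @leq_mulexp c2 _ _ _ hn (leq_maxr g1 g2).
  have := @leq_exp1 7 _ (maxn g1 g2) hn.
  by rewrite !mulnDl; lia.
apply: (@runs_leq _ _ (c1 * n ^ g1 + (n ^ g * ((c2 * n ^ g2 + 5) + (14 + 3 * g)) + (12 + 3 * g)))); last first.
  apply: (runs_seq (IH1 d m hm hG)) => m1 [hm1 hv1].
  have hm1' : agree base m1 A by apply: agree_trans hm; apply: agree_leq hm1; rewrite leq_addr.
  (* Invariant: register [d] holds the fold of the first [i] rounds, and everything below it is
     unchanged. *)
  pose I (i : nat) (m' : memory) := agree (base + d) m' m /\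
    m' (base + d)%N 0 = iteri i (fun i acc => teval n A (f' i%:Z acc)) (teval n A e').
  apply: (@runs_for _ _ _ _ _ n I); first by rewrite hm1'.
    split; first by apply: (agree_trans (agree_update _ _ _ _)) => //; lia.
    by rewrite /update /= hv1; case: eqP => //; lia.
  move=> i m' hi h0 hl [hI1 hI2].
  have hm' : agree base m' A by apply: agree_trans hm; apply: agree_leq hI1; rewrite leq_addr.
  apply: (runs_seq (IH2 d.+1 i%:Z d _ d.+2 m' hm' _)) => [|m2 [hm2 hv2]].
    move=> l v /= [[<- <-]|[[<- <-]|hin]]; split=> //; try lia.
      by have [hld _] := hG _ _ hin; lia.
    by have [_ hv] := env_ok_agree hI1 hG hin.
  apply: runs_weaken (runs_write _ _ _ _) _ _ => //= m'' ->.
  have hne : (base + d.+1 == base + d)%N = false by apply/eqP; lia.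
  have hm2' : agree (base + d) m2 m.
    by apply: agree_trans hI1; apply: agree_leq hm2; lia.
  split.
  + by rewrite /update /= hm2' ?hm.
  + by rewrite /update hne /= hm2 //; lia.
  + split; first by do 2!(apply: (agree_trans (agree_update _ _ _ _)); first by lia).
    by rewrite /update eq_sym hne !eqxx /= hv2 hI2.
(* All powers of n are bounded by the largest one; [19 + 3 * g] per round and [12 + 3 * g] once add
   up to the [31 + 6 * g] of [rel_fold]. *)
have := @leq_mulexp c1 _ _ _ hn (leq_maxl g1 (g + g2)).
have := @leq_mulexp c2 _ _ _ hn (leq_maxr g1 (g + g2)).
have := @leq_mulexp (19 + 3 * g) _ _ _ hn (leq_trans (leq_addr g2 g) (leq_maxr g1 (g + g2))).
have := @leq_exp1 (12 + 3 * g) _ (maxn g1 (g + g2)) hn.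
have -> : (n ^ g * (c2 * n ^ g2 + 5 + (14 + 3 * g)) = c2 * n ^ (g + g2) + (19 + 3 * g) * n ^ g)%N.
  by rewrite expnD; lia.
move: (n ^ maxn _ _)%N (n ^ g)%N (n ^ (g + g2))%N (n ^ g1)%N => X a b x h4 h3 h2 h1.
by nia.
Qed.

(** No statement assigns to array 0, so the cell read by every compiled loop test keeps the value
    n. *)
Lemma srun_size n (A : memory) G c g s s' : A 0%N 0 = n%:Z -> stmt_rel G c g s s' ->
  srun n s' A 0%N 0 = n%:Z.
Proof.
move=> hA h; elim: h A hA => {G c g s s'} //=.
- by move=> G c1 g1 c2 g2 a i i' e e' /andP[ha _] _ _ A hA; rewrite /update; case: eqP => //; lia.
- by move=> G c1 g1 c2 g2 s1 s1' s2 s2' _ IH1 _ IH2 A hA; apply/IH2/IH1.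
- by move=> G c0 g0 c1 g1 c2 g2 e e' s1 s1' s2 s2' _ _ IH1 _ IH2 A hA; case: ifP => _; [apply: IH1|apply: IH2].
- move=> G c g h f f' _ IH A hA; move: (n ^ h)%N => N; elim: N => //= i IHi; exact: (IH 0%N).
Qed.

(** The data arrays follow the reference semantics [srun]; registers below [d] must survive because
    they hold the indices of the enclosing loops. *)
Lemma scomp_correct n G c g s s' : (0 < n)%N ->
  stmt_rel G c g s s' ->
  forall d m (A : memory), A 0%N 0 = n%:Z -> agree base m A -> env_ok G d m ->
  runs (scomp d s) m (c * n ^ g) (fun m' => agree base m' (srun n s' A) /\
    (forall l, (l < d)%N -> m' (base + l)%N 0 = m (base + l)%N 0)).
Proof.
move=> hn; elim=> {G c g s s'}
  [G c1 g1 c2 g2 a i i' e e' ha hi he|G c1 g1 c2 g2 s1 s1' s2 s2' h1 IH1 _ IH2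
  |G c0 g0 c1 g1 c2 g2 e e' s1 s1' s2 s2' he _ IH1 _ IH2|G c g gf f f' h IH] d m A hA hm hG.
- apply: (@runs_leq _ _ (c1 * n ^ g1 + (c2 * n ^ g2 + 5))); last first.
    apply: (runs_seq (tcomp_correct hn hA hi hm hG)) => m1 [hm1 hv1].
    have hm1' : agree base m1 A by apply: agree_trans hm; apply: agree_leq hm1; rewrite leq_addr.
    have hG1 := env_ok_leq (leqnSn d) (env_ok_agree hm1 hG).
    apply: (runs_seq (tcomp_correct hn hA he hm1' hG1)) => m2 [hm2 hv2].
    have hm2' : agree (base + d) m2 m by apply: agree_trans hm1; apply: agree_leq hm2; lia.
    apply: runs_weaken (runs_write _ _ _ _) _ _ => //= m' ->; split.
      move=> x j hx; rewrite /update /= hv2 (hm2 (base + d)%N) ?hv1; last by lia.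
      by case: ifP => // _; rewrite hm2' ?hm //; lia.
    move=> l hl; rewrite /update.
    by case: eqP => [e0|_]; [lia | rewrite /= hm2' ?ltn_add2l].
  have := @leq_mulexp c1 _ _ _ hn (leq_maxl g1 g2).
  have := @leq_mulexp c2 _ _ _ hn (leq_maxr g1 g2).
  have := @leq_exp1 5 _ (maxn g1 g2) hn.
  by rewrite !mulnDl; lia.
- apply: (@runs_leq _ _ (c1 * n ^ g1 + c2 * n ^ g2)); last first.
    apply: (runs_seq (IH1 d m A hA hm hG)) => m1 [hm1 hr1].
    have hG1 : env_ok G d m1.
      by move=> l v /hG [hl <-]; split=> //; exact: hr1.
    have := IH2 d m1 _ (srun_size hA h1) hm1 hG1.
    move/runs_weaken; apply=> // m2 [hm2 hr2]; split=> // l hl.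
    by rewrite hr2 ?hr1.
  have := @leq_mulexp c1 _ _ _ hn (leq_maxl g1 g2).
  have := @leq_mulexp c2 _ _ _ hn (leq_maxr g1 g2).
  by rewrite !mulnDl; lia.
- apply: (@runs_leq _ _ (c0 * n ^ g0 + (c1 * n ^ g1 + c2 * n ^ g2 + 3))); last first.
    apply: (runs_seq (tcomp_correct hn hA he hm hG)) => m1 [hm1 hv1].
    have hm1' : agree base m1 A by apply: agree_trans hm; apply: agree_leq hm1; rewrite leq_addr.
    have hG1 := env_ok_agree hm1 hG.
    have hr : forall l, (l < d)%N -> m1 (base + l)%N 0 = m (base + l)%N 0.
      by move=> l hl; apply: hm1; rewrite ltn_add2l.
    rewrite /= -hv1; case: (eqVneq (m1 (base + d)%N 0) 0) => hz.
      have [t [m2 [ex ht [hm2 hr2]]]] := IH2 d m1 A hA hm1' hG1.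
      exists (expr_time (reg d) + t).+1, m2; split; last by split=> // l hl; rewrite hr2 ?hr.
        exact: exec_if_false.
      by rewrite /=; lia.
    have [t [m2 [ex ht [hm2 hr2]]]] := IH1 d m1 A hA hm1' hG1.
    exists (expr_time (reg d) + t).+1, m2; split; last by split=> // l hl; rewrite hr2 ?hr.
      exact: exec_if_true.
    by rewrite /=; lia.
  set M := maxn g0 _.
  have h0 : (g0 <= M)%N by rewrite leq_maxl.
  have h1 : (g1 <= M)%N by rewrite /M; lia.
  have h2 : (g2 <= M)%N by rewrite /M; lia.
  have := @leq_mulexp c0 _ _ _ hn h0.
  have := @leq_mulexp c1 _ _ _ hn h1.
  have := @leq_mulexp c2 _ _ _ hn h2.
  have := @leq_exp1 3 _ M hn.
  by rewrite !mulnDl; lia.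
apply: (@runs_leq _ _ (n ^ gf * (c * n ^ g + (14 + 3 * gf)) + (12 + 3 * gf))).
  have := @leq_mulexp (14 + 3 * gf) _ _ _ hn (leq_addr g gf).
  have := @leq_exp1 (12 + 3 * gf) _ (gf + g) hn.
  have -> : (n ^ gf * (c * n ^ g + (14 + 3 * gf)) = c * n ^ (gf + g) + (14 + 3 * gf) * n ^ gf)%N.
    by rewrite expnD; lia.
  move: (n ^ (gf + g))%N (n ^ gf)%N => X a h2 h1; nia.
pose I (i : nat) (m' : memory) := agree base m' (iteri i (fun i => srun n (f' i%:Z)) A) /\
    (forall l, (l < d)%N -> m' (base + l)%N 0 = m (base + l)%N 0).
  apply: (@runs_for _ _ _ _ _ n I); first by rewrite hm.
    split=> [|l hl]; first by apply: (agree_trans (agree_update _ _ _ _)) => //; lia.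
    by rewrite /update; case: eqP => // e0; lia.
  move=> i m' hi h0 hl [hI1 hI2].
  have hA' : iteri i (fun i => srun n (f' i%:Z)) A 0%N 0 = n%:Z.
    by elim: (i) => //= j IHj; apply: (srun_size IHj (h 0%N j%:Z)).
  have hG' : env_ok ((d, i%:Z) :: G) d.+1 m'.
    move=> l v /= [[<- <-]|hin]; first by split.
    by have [hld <-] := hG _ _ hin; split; [lia | exact: hI2].
  apply: (runs_weaken (IH d i%:Z d.+1 m' _ hA' hI1 hG')) => // m2 [hm2 hr2].
  split; first by rewrite hm2 // (srun_size hA' (h 0%N i%:Z)).
    by rewrite hr2.
  split=> [|l hld]; first by apply: (agree_trans (agree_update _ _ _ _)) => //; lia.
  rewrite /update hr2; last by lia.
  by rewrite hI2 //; case: eqP => // e0; lia.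
Qed.

(** * Weights of Hamilton cycles *)

(** At most one edge has the endpoints i and j, and none if i = j. In this form, sums over edges and
    sums over pairs can be exchanged. *)
Lemma entry_sum n (u : weighting n) (i j : 'I_n) :
  entry u i j = \sum_(e : edge n | val e == [set i; j]) u e.
Proof.
rewrite /entry; case: insubP => [e _ he|hn] /=.
  by rewrite (big_pred1 e) // => e'; rewrite -he /= (inj_eq val_inj).
by rewrite big_pred0 // => e; apply/negP=> /eqP he; case/negP: hn; rewrite -he (valP e).
Qed.

Lemma entryC n (u : weighting n) (i j : 'I_n) : entry u i j = entry u j i.
Proof. by rewrite /entry setUC. Qed.

Lemma entry_diag n (u : weighting n) (i : 'I_n) : entry u i i = 0.
Proof. by rewrite /entry setUid insubF // cards1. Qed.

Lemma eq_set2 (T : finType) (x y a b : T) : [set x; y] = [set a; b] ->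
  (x = a /\ y = b) \/ (x = b /\ y = a).
Proof.
move=> h.
have : x \in [set a; b] by rewrite -h !inE eqxx.
have : y \in [set a; b] by rewrite -h !inE eqxx orbT.
have : a \in [set x; y] by rewrite h !inE eqxx.
have : b \in [set x; y] by rewrite h !inE eqxx orbT.
rewrite !inE => /orP[]/eqP ? /orP[]/eqP ? /orP[]/eqP ? /orP[]/eqP ?; subst; tauto.
Qed.

Lemma edge_set n (e : edge n) : exists i j : 'I_n, (j < i)%N /\ val e = [set i; j].
Proof.
have /cards2P [x [y [xy he]]] := valP e.
case: (ssrnat.ltngtP x y) => h; [by exists y, x; rewrite setUC | by exists x, y |].
by rewrite (val_inj h) eqxx in xy.
Qed.

Lemma sum_edges n (f : edge n -> int) :
  \sum_e f e = \sum_(i < n) \sum_(j < n | (j < i)%N) entry f i j.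
Proof.
rewrite (pair_big_dep xpredT) /=.
under [RHS]eq_bigr do rewrite entry_sum.
rewrite (exchange_big_dep xpredT) //=; apply: eq_bigr => e _.
have [i [j [ji he]]] := edge_set e.
rewrite (big_pred1 (i, j)) // => -[x y] /=; rewrite he.
apply/andP/eqP => [[yx /eqP /eq_set2 [] [? ?]]|[-> ->]]; subst => //; lia.
Qed.

Lemma sum_edges_pairs n (f : edge n -> int) :
  2 * \sum_e f e = \sum_(i < n) \sum_(j < n) entry f i j.
Proof.
rewrite mulr2n mulrDl !mul1r {1}sum_edges.
have -> : \sum_e f e = \sum_(i < n) \sum_(j < n | (i < j)%N) entry f i j.
  rewrite sum_edges (exchange_big_dep xpredT) //=; apply: eq_bigr => i _.
  by apply: eq_bigr => j _; rewrite entryC.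
rewrite -big_split; apply: eq_bigr => i _.
rewrite [RHS](bigID (fun j : 'I_n => (j < i)%N)) /=; congr (_ + _).
rewrite [RHS](bigD1 i) ?ltnn //= entry_diag add0r.
by apply: eq_bigl => j; rewrite -leqNgt ltn_neqAle eq_sym andbC -val_eqE.
Qed.

Section Traversal.

Variables (n : nat) (p : seq 'I_n).
Hypotheses (n3 : (2 < n)%N) (p_uniq : uniq p) (p_size : size p = n).

Lemma mem_traversal x : x \in p.
Proof.
have : #|p| = #|'I_n| by rewrite card_ord (card_uniqP p_uniq).
by move=> h; have := subset_cardP h (subset_predT _) x; rewrite inE.
Qed.

Lemma next_nth_mod x0 (i : nat) : (i < n)%N ->
  next p (nth x0 p i) = nth x0 p (i.+1 %% n).
Proof.
move=> hi; rewrite next_nth mem_nth ?p_size //.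
case: p p_uniq p_size => [|y p'] hu hs; first by rewrite -hs in hi.
rewrite index_uniq ?hs //; case: (ssrnat.ltngtP i.+1 n) hi => // hi _.
  by rewrite modn_small //=; apply: set_nth_default; rewrite /= -hs in hi.
by rewrite hi modnn /= nth_default //; move: hs => /=; lia.
Qed.

Lemma next_inj : injective (next p).
Proof. exact: can_inj (prev_next p_uniq). Qed.

(** Positions i and i + 2 differ modulo n because n > 2. Hence no edge is traversed in both
    directions. *)
Lemma next_next_neq x : next p (next p x) != x.
Proof.
have xp := mem_traversal x.
have hi : (index x p < n)%N by have := xp; rewrite -index_mem p_size.
have := nth_index x xp; move: (index x p) hi => i hi <-.
have h1 : (i.+1 %% n < n)%N by rewrite ltn_mod; lia.
rewrite !next_nth_mod // nth_uniq ?p_size ?ltn_mod //; try lia.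
rewrite -addn1 modnDml addn1; apply/eqP=> h.
have := eqn_modDl i 2 0 n; rewrite addn2 addn0 h.
by rewrite (modn_small hi) eqxx mod0n modn_small.
Qed.

(** Each edge of the cycle leaves exactly one vertex: a second one would traverse it backwards,
    against [next_next_neq]. *)
Lemma weight_traversal (u : weighting n) :
  weight u (cycle_edges p) = \sum_x entry u x (next p x).
Proof.
under [RHS]eq_bigr do rewrite entry_sum.
rewrite (exchange_big_dep xpredT) //= /weight big_mkcond /=; apply: eq_bigr => e _.
rewrite inE; case: existsP => [[x /andP[_ /eqP hx]]|h].
  rewrite (big_pred1 x) // => y; rewrite hx; apply/eqP/eqP => [/eq_set2|->] //.
  case=> [[->]//|[h1 h2]].
  by have := next_next_neq x; rewrite h2 -h1 eqxx.
by rewrite big_pred0 // => y; apply/negP => hy; apply: h; exists y; rewrite mem_traversal.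
Qed.

Lemma sum_traversal x0 (F : 'I_n -> 'I_n -> int) :
  \sum_x F x (next p x) = \sum_(i < n) F (nth x0 p i) (nth x0 p (i.+1 %% n)).
Proof.
rewrite (reindex (fun i : 'I_n => nth x0 p i)) /=.
  by apply: eq_bigr => i _; rewrite next_nth_mod.
apply: onW_bij; apply: injF_bij => i j /eqP.
by rewrite nth_uniq ?p_size // => /eqP /val_inj.
Qed.

(** Every vertex starts one edge of the cycle and ends one, so a potential contributes the same to
    all Hamilton cycles. *)
Lemma sum_potential (F : 'I_n -> int) :
  \sum_x (F x + F (next p x)) = 2 * \sum_x F x.
Proof.
by rewrite big_split /= [in RHS]mulr2n mulrDl !mul1r {3}(reindex_inj next_inj).
Qed.

End Traversal.

(** * Conditional expectations *)

Section Expectation.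

Variable n : nat.
Implicit Types (s vs : seq 'I_n) (ps : seq nat).

Definition fits s (q : nat) (a : 'I_n) : bool :=
  if (q < size s)%N then nth a s q == a else a \notin s.

(* The number of permutations that extend the prefix [s] and take the values
   [vs] at the positions [ps]. *)
Definition extensions s ps vs : nat :=
  if all2 (fits s) ps vs then (n - size s - count (leq (size s)) ps)`! else 0.

(** Placing x at position [size s] adds one requirement: the position is the new one exactly when
    the value is x. *)
Lemma fits_rcons s x q a : x \notin s ->
  fits (rcons s x) q a = fits s q a && ((q == size s) == (a == x)).
Proof.
move=> xs; rewrite /fits size_rcons ltnS nth_rcons mem_rcons inE.
case: (ssrnat.ltngtP q (size s)) => [h|h|_]; last 1 first.
- by rewrite eq_sym; case: eqP => [->|]; rewrite ?xs ?andbF.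
- case: eqP => [ea|//] /=; apply/esym/eqP/esym/negbTE; apply: contraNneq xs => <-; rewrite -ea mem_nth //.
- by rewrite negb_or andbC; case: eqP.
Qed.

(** Both sides say that q and x occur at the same place of the two lists, or in neither; an absent
    element has the common size as its index. *)
Lemma all2_pred1 ps vs q x : size ps = size vs -> uniq ps -> uniq vs ->
  all2 (fun p a => (p == q) == (a == x)) ps vs = (index q ps == index x vs).
Proof.
elim: ps vs => [|p ps IH] [|a vs] //= [hs] /andP[pps ups] /andP[avs uvs].
rewrite IH //; case: (eqVneq p q) => [ep|_]; case: (eqVneq a x) => [ea|_] //=.
by rewrite -ep -ea (memNindex pps) (memNindex avs) hs !eqxx.
Qed.

Lemma all2_fits_rcons s x ps vs : x \notin s ->
  size ps = size vs -> uniq ps -> uniq vs ->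
  all2 (fits (rcons s x)) ps vs =
  all2 (fits s) ps vs && (index (size s) ps == index x vs).
Proof.
move=> xs hs ups uvs; rewrite -all2_pred1 // => {ups uvs}.
elim: ps vs hs => [|p ps IH] [|a vs] //= [hs].
by rewrite fits_rcons // IH // andbACA.
Qed.

(** Where a constraint fits, its position is unfilled exactly when its value is unplaced. *)
Lemma count_fits s ps vs : all2 (fits s) ps vs ->
  count (leq (size s)) ps = count [predC s] vs.
Proof.
elim: ps vs => [|p ps IH] [|a vs] //= /andP[hp /IH ->]; congr (nat_of_bool _ + _)%N.
move: hp; rewrite /fits /=; case: ltnP => // hp /eqP <-.
by rewrite mem_nth.
Qed.

Lemma card_notin_seq (t : seq 'I_n) : uniq t ->
  #|[pred x | x \notin t]| = (n - size t)%N.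
Proof.
move=> ut; have := cardC [in t]; rewrite card_ord (card_uniqP ut) => e; rewrite -[X in _ = (X - _)%N]e addKn; exact: eq_card.
Qed.

(** A permutation extending [s] is classified by its value x at position [size s]. If this position
    is constrained, one x survives and the factorial stays; otherwise the surviving x supply the
    factor by which the factorial drops. *)
Lemma extensions_tower s ps vs : uniq s -> (size s < n)%N ->
  uniq ps -> all (fun p => p < n)%N ps -> uniq vs -> size ps = size vs ->
  extensions s ps vs = (\sum_(x | x \notin s) extensions (rcons s x) ps vs)%N.
Proof.
move=> us hsn ups hps uvs hsz.
rewrite (eq_bigr (fun x => if all2 (fits s) ps vs && (index (size s) ps == index x vs)
  then (n - (size s).+1 - count (leq (size s).+1) ps)`! else 0%N)); last first.
  by move=> x xs; rewrite /extensions all2_fits_rcons // size_rcons.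
rewrite /extensions; case: ifP => [hall|_] /=; last by rewrite big1.
(* Filling position [size s] removes one open constraint exactly when that position is
   constrained. *)
have hc : count (leq (size s)) ps = (count (leq (size s).+1) ps + (size s \in ps))%N.
  rewrite -(count_uniq_mem _ ups) addnC -count_predUI.
  rewrite [X in (_ + X)%N](eq_count (a2 := pred0)) ?count_pred0 ?addn0.
    by apply: eq_count => q /=; rewrite leq_eqVlt eq_sym.
  by move=> q /=; case: eqP => // ->; rewrite ltnn.
case: (boolP (size s \in ps)) hc => hk hc.
  have hi : (index (size s) ps < size vs)%N by rewrite -hsz index_mem.
  have x0 : 'I_n := Ordinal hsn.
  pose x := nth x0 vs (index (size s) ps).
  have xs : x \notin s.
    have := hall; rewrite all2E hsz eqxx /= => /(all_nthP (0%N, x0)).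
    move/(_ (index (size s) ps)); rewrite size_zip hsz minnn nth_zip //= => /(_ hi).
    by rewrite /fits nth_index // ltnn.
  rewrite (bigD1 x) //= index_uniq // eqxx big1 ?addn0 => [|y /andP[_ yx]].
    by congr (_ `!)%N; rewrite hc; lia.
  case: eqP => // h; case/eqP: yx; rewrite /x h nth_index //.
  by rewrite -index_mem -h.
rewrite (eq_bigr (fun x => if x \notin vs then (n - (size s).+1 - count (leq (size s).+1) ps)`!
   else 0%N)); last first.
  by move=> x _; rewrite (memNindex hk) hsz eq_sym eqn_leq index_size leqNgt index_mem.
rewrite -big_mkcondr sum_nat_const addn0 in hc *.
(* The admissible x are neither placed nor reserved; removing the placed values from [vs] makes the
   list of forbidden values duplicate-free. *)
rewrite (eq_card (B := [pred x | x \notin s ++ filter [predC s] vs])); last first.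
  by move=> x; rewrite [in RHS]inE mem_cat mem_filter negb_or negb_and unfold_in /=; case: (x \in s).
rewrite card_notin_seq; last first.
  by rewrite cat_uniq us filter_uniq // andbT; apply/hasPn => x; rewrite mem_filter => /andP[].
rewrite size_cat size_filter -(count_fits hall) hc subnDA.
(* The open constraints occupy distinct positions beyond [size s], so the truncated subtractions are
   exact. *)
have hle : (count (leq (size s).+1) ps <= n - (size s).+1)%N.
  rewrite -size_filter -(size_iota (size s).+1 (n - (size s).+1)).
  apply: uniq_leq_size; first exact: filter_uniq.
  move=> q; rewrite mem_filter mem_iota => /andP[hq /(allP hps) hqn]; lia.
have -> : (n - size s - count (leq (size s).+1) ps =
           (n - (size s).+1 - count (leq (size s).+1) ps).+1)%N by lia.
by rewrite -factS; congr (_ `!)%N; lia.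
Qed.
End Expectation.

(** * Sums over quadruples of vertices *)

Section Sum4.

Variable n : nat.
Implicit Types F G : 'I_n -> 'I_n -> 'I_n -> 'I_n -> int.

Definition sum4 F : int := \sum_a \sum_b \sum_c \sum_d F a b c d.

Lemma eq_sum4 F G : (forall a b c d, F a b c d = G a b c d) -> sum4 F = sum4 G.
Proof. by move=> h; do 4!(apply: eq_bigr => ? _). Qed.

Lemma ler_sum4 F G : (forall a b c d, F a b c d <= G a b c d) -> sum4 F <= sum4 G.
Proof. by move=> h; do 4!(apply: ler_sum => ? _). Qed.

Lemma sum4D F G : sum4 (fun a b c d => F a b c d + G a b c d) = sum4 F + sum4 G.
Proof. by rewrite /sum4; do 4!(rewrite -big_split /=; apply: eq_bigr => ? _). Qed.

Lemma sum4Z x F : sum4 (fun a b c d => x * F a b c d) = x * sum4 F.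
Proof. by rewrite /sum4; do 4!(rewrite mulr_sumr /=; apply: eq_bigr => ? _). Qed.

Lemma sum4_exchange (I : Type) (r : seq I) (P : pred I)
  (F : I -> 'I_n -> 'I_n -> 'I_n -> 'I_n -> int) :
  \sum_(i <- r | P i) sum4 (F i) =
  sum4 (fun a b c d => \sum_(i <- r | P i) F i a b c d).
Proof. by rewrite /sum4; do 4!(rewrite exchange_big /=; apply: eq_bigr => ? _). Qed.

Lemma sum4_swap12 F : sum4 F = sum4 (fun a b c d => F b a c d).
Proof. exact: exchange_big. Qed.

Lemma sum4_swap23 F : sum4 F = sum4 (fun a b c d => F a c b d).
Proof. by apply: eq_bigr => a _; exact: exchange_big. Qed.

Lemma sum4_swap34 F : sum4 F = sum4 (fun a b c d => F a b d c).
Proof. by do 2!(apply: eq_bigr => ? _); exact: exchange_big. Qed.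

Lemma sum4_rev F : sum4 F = sum4 (fun a b c d => F d c b a).
Proof.
by rewrite sum4_swap12 sum4_swap23 sum4_swap34 sum4_swap12 sum4_swap23 sum4_swap12.
Qed.

Lemma sum4_pred1 F a0 b0 c0 d0 :
  sum4 (fun a b c d => if [&& a0 == a, b0 == b, c0 == c & d0 == d]
                       then F a b c d else 0) = F a0 b0 c0 d0.
Proof.
rewrite /sum4 (bigD1 a0) //= [X in _ + X]big1 ?addr0 => [|a ha]; last first.
  by do 3!(apply: big1 => ? _); rewrite eq_sym (negbTE ha).
rewrite (bigD1 b0) //= [X in _ + X]big1 ?addr0 => [|b hb]; last first.
  by do 2!(apply: big1 => ? _); rewrite (eq_sym b0) (negbTE hb) andbF.
rewrite (bigD1 c0) //= [X in _ + X]big1 ?addr0 => [|c hc]; last first.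
  by apply: big1 => ? _; rewrite (eq_sym c0) (negbTE hc) !andbF.
rewrite (bigD1 d0) //= [X in _ + X]big1 ?addr0 => [|d hd]; last first.
  by rewrite (eq_sym d0) (negbTE hd) !andbF.
by rewrite !eqxx.
Qed.

End Sum4.

(** * Blocks, the conditional expectation and the greedy choice of an order *)

Section Weights.

Variables (n : nat) (e : 'I_n -> 'I_n -> int).
Hypotheses (eC : forall i j, e i j = e j i) (e_diag : forall i, e i i = 0).

Implicit Types s : seq 'I_n.

(** What the path a, b, c, d saves when b and c are exchanged; the edge bc remains. *)
Definition Delta a b c d : int := e a b + e c d - e a c - e b d.

(** Counted from the start of the block that contains q; the remainder closes the cycle after the
    last position. *)
Definition pos (q l : nat) : nat := ((q %/ 3 * 3 + l) %% n)%N.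

Definition window (q : nat) : seq nat := [:: pos q 0; pos q 1; pos q 2; pos q 3].

(** An incomplete last block is never changed. *)
Definition swaps (q : nat) a b c d : bool :=
  (q %/ 3 * 3 + 3 <= n)%N && (0 < Delta a b c d).

(* The weight of the [q]-th edge of the tour, after the best choice of order for
   the two inner vertices of its block [a, b, c, d]. *)
Definition cost (q : nat) a b c d : int :=
  let s := swaps q a b c d in
  if (q %% 3)%N == 0%N then e a (if s then c else b)
  else if (q %% 3)%N == 1%N then e b c
  else e (if s then b else c) d.

Definition distinct (F : 'I_n -> 'I_n -> 'I_n -> 'I_n -> int) a b c d : int :=
  if uniq [:: a; b; c; d] then F a b c d else 0.

(** The cost of the improved tour, totalled over all permutations that extend [s]: (n - [size s])!
    times its conditional expectation. *)
Definition estimate s : int :=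
  \sum_(q < n) sum4 (distinct (fun a b c d =>
    (extensions s (window q) [:: a; b; c; d])%:Z * cost q a b c d)).

Hypothesis n4 : (3 < n)%N.

Lemma pos_inj q l l' : (l < 4)%N -> (l' < 4)%N -> (pos q l == pos q l') = (l == l').
Proof. by move=> hl hl'; rewrite /pos eqn_modDl !modn_small //; lia. Qed.

Lemma window_uniq q : uniq (window q).
Proof. by rewrite /= !inE !pos_inj. Qed.

Lemma pos_ltn q l : (pos q l < n)%N.
Proof. by rewrite ltn_mod; lia. Qed.

Lemma window_ltn q : all (fun p => p < n)%N (window q).
Proof. by rewrite /= !pos_ltn. Qed.

Lemma estimate_tower s : uniq s -> (size s < n)%N ->
  estimate s = \sum_(x | x \notin s) estimate (rcons s x).
Proof.
move=> us hs; rewrite /estimate [RHS]exchange_big /=; apply: eq_bigr => q _.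
rewrite sum4_exchange; apply: eq_sum4 => a b c d; rewrite /distinct.
case: ifP => u; last by rewrite big1.
by rewrite (extensions_tower us hs (window_uniq q) (window_ltn q) u) // (big_morph Posz PoszD (erefl _)) mulr_suml.
Qed.

(** Only one permutation is left, so each window retains just the quadruple that it reads in [s]. *)
Lemma estimate_full x0 s : uniq s -> size s = n ->
  estimate s = \sum_(q < n) cost q (nth x0 s (pos q 0)) (nth x0 s (pos q 1))
                                   (nth x0 s (pos q 2)) (nth x0 s (pos q 3)).
Proof.
move=> us hs; apply: eq_bigr => q _.
rewrite -[RHS](sum4_pred1 (cost q)); apply: eq_sum4 => a b c d.
rewrite /distinct /extensions hs subnn sub0n fact0 /= /fits hs !pos_ltn !andbT.
rewrite (set_nth_default x0 a) ?(set_nth_default x0 b) ?(set_nth_default x0 c) ?(set_nth_default x0 d) ?hs ?pos_ltn //.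
case: ifP; case: ifP => //; rewrite ?mul1r ?mul0r //.
move=> /and4P[/eqP <- /eqP <- /eqP <- /eqP <-].
by rewrite !inE !nth_uniq ?hs ?pos_ltn // !pos_inj.
Qed.

(** The least of n - j summands, taken n - j times, is at most their sum, which [estimate_tower]
    identifies with the previous estimate. These factors accumulate to [n ^_ j]. *)
Lemma greedy (best : seq 'I_n -> 'I_n) :
  (forall s, uniq s -> (size s < n)%N -> best s \notin s /\
    forall y, y \notin s -> estimate (rcons s (best s)) <= estimate (rcons s y)) ->
  forall j, (j <= n)%N ->
  let s := iter j (fun s => rcons s (best s)) [::] in
  [/\ uniq s, size s = j & estimate s * (n ^_ j)%:Z <= estimate [::]].
Proof.
move=> hbest; elim=> [|j IH] hj /=; first by rewrite ffactn0 mulr1.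
have [us hs hE] := IH (ltnW hj); set s := iter _ _ _ in us hs hE *.
have hsn : (size s < n)%N by rewrite hs.
have [hb hmin] := hbest s us hsn.
rewrite rcons_uniq hb size_rcons hs; split=> //.
apply: le_trans hE; rewrite ffactnSr PoszM mulrA mulrAC ler_wpM2r //.
rewrite (estimate_tower us hsn) -hs -(card_notin_seq us) -natz mulr_natr.
rewrite -sumr_const; exact: ler_sum.
Qed.

(** The position in the order [v] of the vertex that the improved tour visits at place q. *)
Definition swapped (v : nat -> 'I_n) (q : nat) : nat :=
  if swaps q (v (pos q 0)) (v (pos q 1)) (v (pos q 2)) (v (pos q 3)) then
    if (q %% 3 == 1)%N then q.+1 else if (q %% 3 == 2)%N then q.-1 else q
  else q.

Lemma swapped_fixed v q : (q %% 3 = 0)%N -> swapped v q = q.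
Proof. by move=> h; rewrite /swapped h /= if_same. Qed.

Lemma swapped_ltn v q : (q < n)%N -> (swapped v q < n)%N.
Proof.
rewrite /swapped => hq; case: ifP => // /andP[h _].
have := divn_eq q 3; have := ltn_mod q 3.
by case: eqP => h1; [|case: eqP => h2]; lia.
Qed.

(** The map sending r to (3 - r) mod 3 fixes 0 and exchanges 1 and 2. *)
Lemma swapped_block v b r : (r < 3)%N ->
  swapped v (b * 3 + r) =
  if swaps (b * 3) (v (pos (b * 3) 0)) (v (pos (b * 3) 1)) (v (pos (b * 3) 2)) (v (pos (b * 3) 3))
  then (b * 3 + (3 - r) %% 3)%N else (b * 3 + r)%N.
Proof.
move=> hr; rewrite /swapped /swaps /pos modnMDl !divnMDl // mulnK // (divn_small hr) addn0.
rewrite (modn_small hr); case: ifP => // _; move: hr.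
by case: r => [|[|[|]]] //= _; rewrite ?addn0 //; lia.
Qed.

Lemma swappedK v : involutive (swapped v).
Proof.
move=> q; have hr : (q %% 3 < 3)%N by rewrite ltn_mod.
rewrite (divn_eq q 3) (swapped_block v _ hr); case: ifP => h; last by rewrite swapped_block // h.
rewrite swapped_block ?ltn_mod // h.
by case: (q %% 3)%N hr => [|[|[|]]].
Qed.

Lemma cost_swapped v q : (q < n)%N ->
  e (v (swapped v q)) (v (swapped v (q.+1 %% n))) =
  cost q (v (pos q 0)) (v (pos q 1)) (v (pos q 2)) (v (pos q 3)).
Proof.
have hr : (q %% 3 < 3)%N by rewrite ltn_mod.
rewrite (divn_eq q 3); move: (q %/ 3)%N (q %% 3)%N hr => b r hr hq.
rewrite (swapped_block v b hr) /cost modnMDl (modn_small hr).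
have posr l : pos (b * 3 + r) l = pos (b * 3) l.
  by rewrite /pos !divnMDl // (divn_small hr) mulnK // addn0.
rewrite !posr {posr}.
have -> a c d f : swaps (b * 3 + r) a c d f = swaps (b * 3) a c d f.
  by rewrite /swaps !divnMDl // (divn_small hr) mulnK // addn0.
have posE l : (b * 3 + l < n)%N -> pos (b * 3) l = (b * 3 + l)%N.
  by move=> h; rewrite /pos mulnK // modn_small.
set s := swaps _ _ _ _ _.
have hs : s -> (b * 3 + 3 <= n)%N by case/andP; rewrite mulnK.
(* Either a next position exists, or the tour closes up at position 0, which starts a block and
   hence never moves. *)
have next : ((b * 3 + r).+1 < n)%N \/
    [/\ (b * 3 + r).+1 = n, pos (b * 3) r.+1 = 0%N & swapped v ((b * 3 + r).+1 %% n) = 0%N].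
  case: (ssrnat.ltngtP (b * 3 + r).+1 n) hq => // h _; first by left.
  right; split=> //; first by rewrite /pos mulnK // addnS h modnn.
  by rewrite h modnn swapped_fixed.
case: r hr hq next => [|[|[|]]] //= _ hq [hn|[hn hp ->]].
- rewrite (modn_small hn) -addnS swapped_block // -/s (posE 0%N) // if_same.
  by case: ifP => [/hs hsn|_]; rewrite posE //; lia.
- have -> : s = false by apply/negbTE/negP => /hs; lia.
  by rewrite hp posE.
- rewrite (modn_small hn) -addnS swapped_block // -/s.
  by case: ifP => [/hs hsn|_]; rewrite !posE //; lia.
- have -> : s = false by apply/negbTE/negP => /hs; lia.
  by rewrite hp posE.
- rewrite (modn_small hn) -addnS swapped_fixed ?modnMDl // (posE 3%N); last by lia.
  by case: ifP => [/hs hsn|_]; rewrite posE //; lia.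
- by rewrite hp; case: ifP => [/hs hsn|_]; rewrite posE //; lia.
Qed.

End Weights.

(** * Expected gain of a random tour *)

Section Averages.

Variables (n : nat) (e : 'I_n -> 'I_n -> int).
Hypotheses (eC : forall i j, e i j = e j i) (e_diag : forall i, e i i = 0).

Definition total_defect : int := sum4 (distinct (fun a b c d => `|Delta e a b c d|)).

Lemma sum4_distinct_rev (F : 'I_n -> 'I_n -> 'I_n -> 'I_n -> int) :
  sum4 (distinct F) = sum4 (distinct (fun a b c d => F d c b a)).
Proof.
rewrite sum4_rev; apply: eq_sum4 => a b c d; rewrite /distinct.
by rewrite -(rev_uniq [:: d; c; b; a]).
Qed.

Lemma sum4_distinct_swap12 (F : 'I_n -> 'I_n -> 'I_n -> 'I_n -> int) :
  sum4 (distinct F) = sum4 (distinct (fun a b c d => F b a c d)).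
Proof.
rewrite sum4_swap12; apply: eq_sum4 => a b c d; rewrite /distinct.
rewrite (perm_uniq (s2 := [:: a; b; c; d])) //.
exact/permPl/(perm_catCA [:: b] [:: a] [:: c; d]).
Qed.

Lemma sum4_distinct_swap23 (F : 'I_n -> 'I_n -> 'I_n -> 'I_n -> int) :
  sum4 (distinct F) = sum4 (distinct (fun a b c d => F a c b d)).
Proof.
rewrite sum4_swap23; apply: eq_sum4 => a b c d; rewrite /distinct.
rewrite (perm_uniq (s2 := [:: a; b; c; d])) // perm_cons.
exact/permPl/(perm_catCA [:: c] [:: b] [:: d]).
Qed.

Lemma distinctD (F G : 'I_n -> 'I_n -> 'I_n -> 'I_n -> int) a b c d :
  distinct (fun a b c d => F a b c d + G a b c d) a b c d =
  distinct F a b c d + distinct G a b c d :> int.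
Proof. by rewrite /distinct; case: ifP; rewrite ?addr0. Qed.

Lemma Delta_rev a b c d : Delta e d c b a = Delta e a b c d.
Proof. rewrite /Delta (eC d c) (eC b a) (eC d b) (eC c a); ring. Qed.

Lemma Delta_swap a b c d : Delta e a c b d = - Delta e a b c d.
Proof. rewrite /Delta; ring. Qed.

Lemma sum4_distinctD F G :
  sum4 (distinct (fun a b c d : 'I_n => F a b c d + G a b c d)) =
  sum4 (distinct F) + sum4 (distinct G).
Proof. by rewrite -sum4D; apply: eq_sum4 => a b c d; rewrite distinctD. Qed.

Lemma eq_sum4_distinct F G : (forall a b c d : 'I_n, F a b c d = G a b c d) ->
  sum4 (distinct F) = sum4 (distinct G).
Proof. by move=> h; apply: eq_sum4 => a b c d; rewrite /distinct h. Qed.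

(* Average over the reversal of the block, then over the exchange of [b] and [c],
   which changes the sign of [Delta]. *)
Lemma average_gain :
  4 * sum4 (distinct (fun a b c d => if 0 < Delta e a b c d then e a b - e a c else 0)) =
  total_defect.
Proof.
set S := sum4 _.
have h1 : S = sum4 (distinct (fun a b c d =>
    if 0 < Delta e a b c d then e c d - e b d else 0)).
  rewrite /S sum4_distinct_rev; apply: eq_sum4_distinct => a b c d.
  by rewrite Delta_rev (eC d c) (eC d b).
have h2 : S + S = sum4 (distinct (fun a b c d =>
    if 0 < Delta e a b c d then Delta e a b c d else 0)).
  rewrite {2}h1 -sum4_distinctD; apply: eq_sum4_distinct => a b c d.
  case: ifP => _; rewrite ?addr0 // /Delta; ring.
have h3 : (S + S) + (S + S) = total_defect.
  rewrite {2}h2 sum4_distinct_swap23 h2 -sum4_distinctD; apply: eq_sum4_distinct => a b c d.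
  rewrite (Delta_swap a b c d) oppr_gt0; case: (ltrgtP (Delta e a b c d) 0) => h.
  - by rewrite ltr0_norm // add0r.
  - by rewrite gtr0_norm // addr0.
  - by rewrite h normr0 addr0.
rewrite -h3; ring.
Qed.

Definition pair_total : int := sum4 (distinct (fun a b c d => e a b)).

Lemma total_defect_ge0 : 0 <= total_defect.
Proof.
apply: sumr_ge0 => a _; do 3!(apply: sumr_ge0 => ? _).
by rewrite /distinct; case: ifP.
Qed.

Definition full_block (q : nat) : bool := (q %% 3 == 0)%N && (q + 3 <= n)%N.

(** The first edge of a full block carries half of the gain of the exchange, evaluated by
    [average_gain]. The middle edge is only reversed, and for the third edge the other half is
    bounded below by 0. *)
Lemma average_cost q :
  4 * sum4 (distinct (cost e q)) <= 4 * pair_total - (full_block q)%:R * total_defect.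
Proof.
have rev_pair : pair_total = sum4 (distinct (fun a b c d => e c d)).
  by rewrite /pair_total sum4_distinct_rev; apply: eq_sum4_distinct => a b c d; rewrite eC.
rewrite /full_block /cost /swaps; case: eqP => [h0|h0] /=.
  have -> : (q %/ 3 * 3)%N = q by have := divn_eq q 3; lia.
  case: leqP => _ /=; last by rewrite mul0r subr0.
  rewrite mul1r -average_gain -mulrBr ler_pM2l // lerBrDr -sum4_distinctD.
  rewrite le_eqVlt; apply/orP; left; apply/eqP/eq_sum4_distinct => a b c d.
  case: ifP => _; ring.
rewrite mul0r subr0 ler_pM2l //; case: eqP => h1 /=.
  rewrite sum4_distinct_swap12 sum4_distinct_swap23 /pair_total.
  rewrite [X in _ <= X]sum4_distinct_swap12.
  rewrite le_eqVlt; apply/orP; left; apply/eqP/eq_sum4_distinct => a b c d; by rewrite eC.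
rewrite rev_pair; case: leqP => _ //=.
have gain0 : 0 <= 4 * sum4 (distinct (fun a b c d =>
    if 0 < Delta e a b c d then e c d - e b d else 0)).
  have -> : sum4 (distinct (fun a b c d => if 0 < Delta e a b c d then e c d - e b d else 0)) =
    sum4 (distinct (fun a b c d => if 0 < Delta e a b c d then e a b - e a c else 0)).
    rewrite sum4_distinct_rev; apply: eq_sum4_distinct => a b c d.
    by rewrite Delta_rev (eC b a) (eC c a).
  by rewrite average_gain total_defect_ge0.
rewrite -subr_ge0 -(pmulr_rge0 _ (_ : 0 < 4 :> int)) //.
apply: le_trans gain0 _; rewrite ler_pM2l // lerBrDr -sum4_distinctD.
rewrite le_eqVlt; apply/orP; left; apply/eqP/eq_sum4_distinct => a b c d.
case: ifP => _; ring.
Qed.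

Lemma card_full_block : ((n %/ 3)%:Z <= \sum_(q < n) (full_block q)%:R).
Proof.
have hm m : \sum_(0 <= q < m * 3) (q %% 3 == 0)%N%:R = m%:Z.
  elim: m => [|m IH]; first by rewrite big_geq.
  rewrite mulSn addnC !addnS addn0 !big_nat_recr //= IH.
  rewrite modnMl -[(m * 3).+1]addn1 -[(m * 3 + 1).+1]addnS !modnMDl /=; lia.
rewrite -(big_mkord xpredT (fun q => (full_block q)%:R)).
have h3 := leq_trunc_div n 3.
rewrite (@big_cat_nat _ _ _ (n %/ 3 * 3)%N) //= -[leLHS]hm -[leLHS]addr0 lerD //.
  rewrite le_eqVlt; apply/orP; left; apply/eqP/eq_big_nat => q /andP[_ hq].
  rewrite /full_block; case: eqP => // hq3; congr (nat_of_bool _)%:R.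
  by have := divn_eq q 3; lia.
by apply: sumr_ge0 => q _; case: (full_block q).
Qed.

Lemma average_total :
  4 * \sum_(q < n) sum4 (distinct (cost e q)) <=
  4 * (n%:Z * pair_total) - (n %/ 3)%:Z * total_defect.
Proof.
apply: (@le_trans _ _ (\sum_(q < n) (4 * pair_total - (full_block q)%:R * total_defect))).
  by rewrite mulr_sumr; apply: ler_sum => q _; exact: average_cost.
rewrite sumrB sumr_const card_ord -mulr_suml [leRHS]addrC [leLHS]addrC. rewrite (_ : 4 * pair_total *+ n = 4 * (n%:Z * pair_total)); last by rewrite -mulr_natl natz; ring.
rewrite lerD2r lerN2.
by rewrite ler_wpM2r ?total_defect_ge0 // card_full_block.
Qed.

(** Two distinct vertices extend to (n - 2)(n - 3) quadruples of distinct vertices, and the diagonal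
    has weight 0. *)
Lemma pair_totalE :
  pair_total = ((n - 2) * (n - 3))%N%:Z * \sum_a \sum_b e a b.
Proof.
rewrite /pair_total /sum4 mulr_sumr; apply: eq_bigr => a _.
rewrite mulr_sumr; apply: eq_bigr => b _.
have [->|ab] := eqVneq a b.
  rewrite e_diag mulr0 big1 // => c _; rewrite big1 // => d _.
  by rewrite /distinct /= !inE eqxx.
rewrite (eq_bigr (fun c => if c \notin [:: a; b] then (n - 3)%N%:Z * e a b else 0)).
  rewrite -big_mkcond sumr_const card_notin_seq /= ?inE ?ab //.
  by rewrite -mulr_natl natz mulrA -PoszM.
move=> c _; case: ifP => hc.
  rewrite (eq_bigr (fun d => if d \notin [:: a; b; c] then e a b else 0)).
    rewrite -big_mkcond sumr_const card_notin_seq; first by rewrite -mulr_natl natz.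
    by move: hc; rewrite /= !inE !negb_or ab (eq_sym a c) (eq_sym b c) /= => /andP[-> ->].
  move=> d _; rewrite /distinct.
  have -> : uniq [:: a; b; c; d] = (d \notin [:: a; b; c]).
    rewrite -(rev_uniq) /= !inE !negb_or (eq_sym b a) ab.
    move: hc; rewrite !inE !negb_or => /andP[-> ->]; by do 3!case: (d == _).
  by [].
rewrite big1 // => d _; rewrite /distinct; case: ifP => //.
move: hc; rewrite /= !inE !negb_or (eq_sym a c) (eq_sym b c).
by do 2!case: (c == _) => //=; rewrite ?andbF ?orbT.
Qed.

End Averages.

(** * Deviations from a potential *)

Section Deviation.

Variables (n : nat) (e : 'I_n -> 'I_n -> int).
Hypotheses (eC : forall i j, e i j = e j i) (e_diag : forall i, e i i = 0).

(* Subtracting from [e] the potential that makes every edge at [x] vanish leaves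
   this matrix; the constant makes it vanish at [y, z] as well. *)
Definition deviation x y z u v : int :=
  if (u == x) || (v == x) then 0
  else e u v - e x u - e x v + (e x y + e x z - e y z).

Lemma deviationC x y z u v : deviation x y z u v = deviation x y z v u.
Proof. by rewrite /deviation orbC (eC u v); case: ifP => // _; ring. Qed.

Let defect := distinct (fun a b c d => `|Delta e a b c d|).

Lemma defect_ge0 a b c d : 0 <= defect a b c d.
Proof. by rewrite /defect /distinct; case: ifP. Qed.

(** Away from x, the deviation equals [Delta u v x y + Delta y v z x]. For v = y these quadruples
    degenerate, and it equals the single term [Delta y u z x]. *)
Lemma deviation_defect x y z u v : x != y -> x != z -> y != z -> u != v ->
  `|deviation x y z u v| <=
  defect u v x y + defect y v z x + (if v == y then defect y u z x else 0).
Proof.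
move=> xy xz yz uv; rewrite /deviation; case: ifP => [_|/norP[ux vx]].
  by rewrite normr0 !addr_ge0 ?defect_ge0 //; case: ifP; rewrite ?defect_ge0.
(* [Delta] vanishes when a = d or b = c, so the coincidences u = y and v = z do no harm. *)
have DeltaE a b c d : a != b -> a != c -> b != d -> c != d ->
    defect a b c d = `|Delta e a b c d|.
  move=> ab ac bd cd; rewrite /defect /distinct /= !inE !negb_or ab ac bd cd /= !andbT.
  case: (eqVneq a d) => [->|_] /=; last case: (eqVneq b c) => [->|_] //=.
  - by rewrite /Delta (eC b d) (eC c d); apply/esym/eqP; rewrite normr_eq0; apply/eqP; ring.
  - by rewrite /Delta; apply/esym/eqP; rewrite normr_eq0; apply/eqP; ring.
have [vy|vy] := eqVneq v y; last first.
  rewrite addr0 !DeltaE //; try by rewrite eq_sym.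
  apply: le_trans (ler_normD _ _); rewrite le_eqVlt; apply/orP; left; apply/eqP.
  by congr (`| _ |); rewrite /Delta (eC u x) (eC z x) (eC v x) (eC v y); ring.
rewrite vy in uv vx *; apply: (@le_trans _ _ (defect y u z x)); last first.
  by rewrite lerDr addr_ge0 ?defect_ge0.
rewrite DeltaE //; try by rewrite eq_sym.
rewrite le_eqVlt; apply/orP; left; apply/eqP.
by congr (`| _ |); rewrite /Delta (eC y u) (eC u x) (eC z x); ring.
Qed.

Lemma sum_distinct3 :
  \sum_(x < n) \sum_(y < n) \sum_(z < n) (uniq [:: x; y; z])%:R =
  (n * (n - 1) * (n - 2))%N%:Z.
Proof.
rewrite (eq_bigr (fun=> ((n - 1) * (n - 2))%N%:Z)) => [|x _].
  by rewrite sumr_const card_ord -mulr_natl natz -PoszM mulnA.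
rewrite (eq_bigr (fun y => if y \notin [:: x] then (n - 2)%N%:Z else 0)) => [|y _].
  by rewrite -big_mkcond sumr_const card_notin_seq // -mulr_natl natz -PoszM.
case: ifP => hy.
  rewrite (eq_bigr (fun z => if z \notin [:: x; y] then 1 else 0)) => [|z _].
    rewrite -big_mkcond sumr_const card_notin_seq ?natz //.
    by move: hy; rewrite /= !inE eq_sym => ->.
  move: hy; rewrite /= !inE !negb_or (eq_sym x) (eq_sym x) (eq_sym y z) => ->.
  by do 2!case: (z == _).
rewrite big1 // => z _; move: hy; rewrite /= !inE (eq_sym y x) !negb_or.
by case: (x == y).
Qed.

(** Sum [deviation_defect] over all triples x, y, z of distinct vertices and all u, v. The first
    term does not involve z and the second does not involve u, so each gives n times the total
    defect; the third forces v = y and gives it once. *)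
Lemma defect_lower_bound (M : int) :
  (forall x y z, M <= \sum_(u < n) \sum_(v < n | (v < u)%N) `|deviation x y z u v|) ->
  (n * (n - 1) * (n - 2))%N%:Z * (2 * M) <= (2 * n + 1)%N%:Z * total_defect e.
Proof.
move=> hM.
pose T x y z u v : int := defect u v x y + defect y v z x +
   (if v == y then defect y u z x else 0).
have hT x y z : uniq [:: x; y; z] -> 2 * M <= \sum_u \sum_v T x y z u v.
  rewrite /= !inE negb_or andbT => /andP[/andP[xy xz] yz].
  apply: (@le_trans _ _ (\sum_u \sum_(v | u != v) `|deviation x y z u v|)); last first.
    apply: ler_sum => u _; rewrite [leRHS](bigID (fun v => u != v)) /=.
    rewrite -[leLHS]addr0 lerD //.
      by apply: ler_sum => v uv; exact: deviation_defect.
    apply: sumr_ge0 => v _; rewrite !addr_ge0 ?defect_ge0 //.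
    by case: ifP; rewrite ?defect_ge0.
  (* The factor 2 passes from unordered to ordered pairs u, v. *)
  have -> : \sum_u \sum_(v | u != v) `|deviation x y z u v| =
    2 * \sum_(u < n) \sum_(v < n | (v < u)%N) `|deviation x y z u v|.
    rewrite mulr2n mulrDl !mul1r [X in _ = _ + X](exchange_big_dep xpredT) //= -big_split.
    apply: eq_bigr => u _; rewrite [LHS](bigID (fun v : 'I_n => (v < u)%N)) /=.
    congr (_ + _).
      by apply: eq_bigl => v; rewrite -val_eqE /=; lia.
    apply: eq_big => [v|v _]; last by rewrite deviationC.
    by rewrite -val_eqE /=; lia.
  by rewrite ler_pM2l.
rewrite -sum_distinct3.
rewrite !mulr_suml.
apply: (@le_trans _ _ (\sum_x \sum_y \sum_z \sum_u \sum_v T x y z u v)).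
  apply: ler_sum => x _; rewrite mulr_suml; apply: ler_sum => y _.
  rewrite mulr_suml; apply: ler_sum => z _.
  case: (boolP (uniq _)) => hu; first by rewrite mul1r; exact: hT.
  rewrite mul0r; do 2!(apply: sumr_ge0 => ? _).
  by rewrite !addr_ge0 ?defect_ge0 //; case: ifP; rewrite ?defect_ge0.
have perm2 : sum4 (fun x y z u => defect y u z x) = total_defect e.
  by rewrite sum4_swap12 sum4_swap23 sum4_swap34 sum4_swap23.
have perm1 : sum4 (fun x y u v => defect u v x y) = total_defect e.
  by rewrite sum4_swap23 sum4_swap12 sum4_swap34 sum4_swap23.
have -> : (2 * n + 1)%N%:Z * total_defect e =
    n%:Z * total_defect e + n%:Z * total_defect e + total_defect e.
  by rewrite PoszD PoszM; ring.
rewrite -{1}perm1 -!perm2 -!sum4Z /sum4.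
rewrite le_eqVlt; apply/orP; left; apply/eqP.
rewrite -!big_split; apply: eq_bigr => x _; rewrite -!big_split; apply: eq_bigr => y _ /=.
rewrite [X in X + _ + _](_ : _ = \sum_(z < n) \sum_u \sum_v defect u v x y); last first.
  rewrite sumr_const card_ord -[RHS]mulr_natl natz mulr_sumr.
  by apply: eq_bigr => u _; rewrite mulr_sumr.
rewrite -!big_split; apply: eq_bigr => z _ /=.
rewrite [X in _ + X + _](_ : _ = \sum_(u < n) \sum_v defect y v z x); last first.
  by rewrite sumr_const card_ord -[RHS]mulr_natl natz mulr_sumr.
rewrite -!big_split; apply: eq_bigr => u _ /=.
by rewrite !big_split /= -[X in _ + X = _]big_mkcond big_pred1_eq.
Qed.

End Deviation.

(** A sum with a single term: the ordered pair of the two endpoints, larger one first. This avoids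
    choosing endpoints. *)
Definition of_matrix n (m : 'I_n -> 'I_n -> int) : weighting n :=
  fun ed => \sum_(p : 'I_n * 'I_n | (p.2 < p.1)%N && (val ed == [set p.1; p.2])) m p.1 p.2.

Lemma entry_of_matrix n (m : 'I_n -> 'I_n -> int) i j :
  (forall i j, m i j = m j i) -> i != j -> entry (of_matrix m) i j = m i j.
Proof.
move=> mC; wlog ji : i j / (j < i)%N => [hw ij|ij].
  case: (ssrnat.ltngtP i j) => h; last by rewrite (val_inj h) eqxx in ij.
    by rewrite entryC mC hw // eq_sym.
  exact: hw.
rewrite /entry; case: insubP => [ed _ he|]; last by rewrite cards2 ij.
rewrite /= /of_matrix he (big_pred1 (i, j)) // => -[x y] /=.
apply/andP/eqP => [[yx /eqP /eq_set2 [] [? ?]]|[-> ->]]; subst => //; lia.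
Qed.

(** * The new weighting and its shift of Hamilton cycles *)

Section Reweighting.

Variables (n : nat) (w : weighting n) (x y z : 'I_n).

Definition reweighting : weighting n := of_matrix (deviation (entry w) x y z).

(** All n edges of a Hamilton cycle receive c, the two at x lose it again, and each w(xv) is
    subtracted on the two edges at v. *)
Definition shift : int :=
  let c := entry w x y + entry w x z - entry w y z in
  c * n%:Z - 2 * c - 2 * \sum_v entry w x v.

Lemma entry_reweighting i j : i != j ->
  entry reweighting i j = deviation (entry w) x y z i j.
Proof. by apply: entry_of_matrix => u v; apply: deviationC; exact: entryC. Qed.

Lemma reweighting_hamilton H : hamilton_cycle H ->
  weight reweighting H = weight w H + shift.
Proof.
case=> p [n3 pu ps ->]; rewrite !(weight_traversal n3 pu ps).
set c := entry w x y + entry w x z - entry w y z.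
(* With the value c at x, the potential [a] gives the deviation of every edge uv, also at x, as
   w(uv) - a(u) - a(v) + c. *)
pose a u : int := entry w x u + (if u == x then c else 0).
have sa : \sum_u a u = \sum_v entry w x v + c.
  by rewrite big_split /= -big_mkcond big_pred1_eq.
have -> : shift = \sum_(u < n) c - 2 * \sum_u a u.
  by rewrite /shift sa sumr_const card_ord -mulr_natl natz -/c; ring.
rewrite -(sum_potential pu) -sumrB -big_split; apply: eq_bigr => u _ /=.
have un : u != next p u.
  apply/eqP => h; have := next_next_neq n3 pu ps u; by rewrite -h -h eqxx.
rewrite entry_reweighting // /deviation /a -/c.
case: (eqVneq u x) un => [->|ux] un /=.
  by rewrite entry_diag eq_sym (negbTE un); ring.
case: eqP => [->|_]; first by rewrite entry_diag (entryC _ u x); ring.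
ring.
Qed.

Lemma abs_weight_reweighting : abs_weight reweighting (complete n) =
  \sum_(u < n) \sum_(v < n | (v < u)%N) `|deviation (entry w) x y z u v|.
Proof.
rewrite /abs_weight (eq_bigl xpredT) => [|ed]; last by rewrite inE.
rewrite sum_edges; apply: eq_bigr => u _; apply: eq_bigr => v vu.
have uv : u != v by rewrite -val_eqE /=; lia.
rewrite -entry_reweighting // /entry; case: insubP => //=.
Qed.

End Reweighting.

(** * Existence of a cheap tour *)

Section GoodTour.

Variables (n k : nat) (w : weighting n).
Hypothesis n_large : (5000 * (k + 1) < n)%N.

Let e := entry w.

Lemma sum_entries : \sum_a \sum_b e a b = 2 * weight w (complete n).
Proof.
rewrite -sum_edges_pairs /weight; congr (_ * _).
by apply: eq_bigl => ed; rewrite inE.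
Qed.

(** The number dn equals 2w(K_n)/(n - 1); the hypothesis is the claim with this denominator
    cleared. *)
Lemma below_density (x : int) :
  (x + k%:Z) * (n%:Z - 1) < 2 * weight w (complete n) ->
  x%:~R < density w * n%:R - k%:R.
Proof.
have n1 : (0 : rat) < n%:R - 1 by rewrite subr_gt0 (ltr_nat _ 1); lia.
move=> h; rewrite /density ltrBrDr.
have -> : 'C(n, 2)%:R = n%:R * (n%:R - 1) / 2 :> rat.
  rewrite bin2 -divn2.
  have h2 : (n * n.-1 = n * n.-1 %/ 2 * 2)%N.
    by rewrite divnK // dvdn2 oddM; case: (n) n_large => //= m _; rewrite andNb.
  have -> : n%:R - 1 = n.-1%:R :> rat by rewrite -subn1 natrB //; lia.
  by rewrite -natrM {2}h2 natrM mulfK.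
have n0 : n%:R != 0 :> rat by rewrite pnatr_eq0; lia.
have -> (W : rat) : W / (n%:R * (n%:R - 1) / 2) * n%:R = 2 * W / (n%:R - 1).
  by field; rewrite n0 lt0r_neq0.
rewrite ltr_pdivlMr //.
move: h; rewrite -(ltr_int rat) !rmorphM rmorphD rmorphB /=.
by rewrite -!pmulrn.
Qed.

Lemma estimate_nil : estimate e [::] =
  (n - 4)`!%:Z * \sum_(q < n) sum4 (distinct (cost e q)).
Proof.
rewrite /estimate mulr_sumr; apply: eq_bigr => q _.
rewrite -sum4Z; apply: eq_sum4 => a b c d; rewrite /distinct.
by case: ifP; rewrite ?mulr0 // /extensions /= subn0.
Qed.

Hypothesis all_heavy : forall x y z, (4000 * k * n)%N%:Z <
  \sum_(u < n) \sum_(v < n | (v < u)%N) `|deviation e x y z u v|.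

(** If the conclusion failed, [average_total] would bound the total defect by roughly 12kn^3,
    whereas heavy deviations force roughly 4000kn^3. *)
Lemma cheap_estimate (x : int) : x * (n ^_ n)%:Z <= estimate e [::] ->
  (x + k%:Z) * (n%:Z - 1) < 2 * weight w (complete n).
Proof.
have eC i j : e i j = e j i by exact: entryC.
have e0 i : e i i = 0 by exact: entry_diag.
(* The summand 1, due to integrality, is what yields the contradiction when k = 0. *)
have M_le i j l : (4000 * k * n)%N%:Z + 1 <=
    \sum_(u < n) \sum_(v < n | (v < u)%N) `|deviation e i j l u v|.
  by rewrite lezD1.
have hD := defect_lower_bound eC M_le.
have hX := average_total eC.
have hW := pair_totalE e0.
rewrite estimate_nil ffactnn.
have -> : n`! = (n ^_ 4 * (n - 4)`!)%N by rewrite ffact_fact //; lia.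
rewrite PoszM mulrA mulrC ler_pM2l ?ltz_nat ?fact_gt0 //.
rewrite sum_entries in hW.
move: hD hX hW; set D := total_defect e; set P := pair_total e.
set W := weight w _; set X := \sum_(q < n) _ => hD hX hW hx.
have D0 : 0 <= D := total_defect_ge0 e.
have en : (n ^_ 4 = n * (n - 1) * (n - 2) * (n - 3))%N.
  by rewrite !ffactnS ffactn0; rewrite -!subn1 -!subnDA muln1 !mulnA.
move: hx hD hW hX; rewrite en.
have e3 : (n - 3)%N%:Z = n%:Z - 3 by lia.
have e2 : (n - 2)%N%:Z = n%:Z - 2 by lia.
have e1 : (n - 1)%N%:Z = n%:Z - 1 by lia.
have hN : n%:Z <= 3 * (n %/ 3)%N%:Z + 2 by lia.
rewrite !PoszM PoszD PoszM e1 e2 e3.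
have hk : (0 : int) <= k%:Z by [].
have hn : 5000 <= n%:Z by lia.
move: (n %/ 3)%N%:Z (n%:Z) (k%:Z) hN hn hk => N m K hN hm hK hx hD hW hX.
rewrite ltNge; apply/negP => hge.
pose Q : int := m * (m - 1) * (m - 2).
have Q0 : 0 < Q by rewrite /Q !mulr_gt0 //; lia.
(* The upper bound on the defect: the negated goal replaces 2W by (x + K)(m - 1), and the terms in x
   cancel. *)
have h1 : N * D <= 4 * K * (m - 3) * Q.
  have : 4 * (m * ((m - 2) * (m - 3))) * (2 * W) <=
         4 * (m * ((m - 2) * (m - 3))) * ((x + K) * (m - 1)).
    by rewrite ler_wpM2l // !mulr_ge0 //; lia.
  move: hx hX; rewrite hW /Q; lia.
have h2 : N * Q * (2 * (4000 * K * m + 1)) <= (2 * m + 1) * (4 * K * (m - 3) * Q).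
  apply: (@le_trans _ _ (N * ((2 * m + 1) * D))).
    by rewrite -mulrA ler_wpM2l //; lia.
  by rewrite mulrCA ler_wpM2l //; lia.
have h3 : N * (2 * (4000 * K * m + 1)) <= (2 * m + 1) * (4 * K * (m - 3)).
  by rewrite -(ler_pM2r Q0); move: h2; lia.
(* Tripling [h3] now compares about 8000Km^2 on the left with about 24Km^2 on the right. *)
have h4 : (m - 2) * (2 * (4000 * K * m + 1)) <= 3 * N * (2 * (4000 * K * m + 1)).
  rewrite ler_wpM2r //; last by lia.
  by rewrite mulr_ge0 // addr_ge0 // !mulr_ge0 //; lia.
have h5 : 0 <= K * m * (m - 2) by rewrite !mulr_ge0 //; lia.
have h6 : 0 <= K * (m - 2) by rewrite !mulr_ge0 //; lia.
have h7 : 0 <= K * m by rewrite !mulr_ge0 //; lia.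
lia.
Qed.

Variables (s : seq 'I_n) (x0 : 'I_n).
Hypotheses (s_uniq : uniq s) (s_size : size s = n).

Definition tour : seq 'I_n := [seq nth x0 s (swapped e (nth x0 s) q) | q <- iota 0 n].

Lemma nth_tour q : (q < n)%N -> nth x0 tour q = nth x0 s (swapped e (nth x0 s) q).
Proof. by move=> hq; rewrite (nth_map 0%N) ?size_iota // nth_iota. Qed.

(** The positions are permuted by the involution [swapped], so no vertex repeats. *)
Lemma tour_traverses : traverses tour (cycle_edges tour).
Proof.
have n4 : (3 < n)%N by lia.
split=> //; [by lia | | by rewrite size_map size_iota].
rewrite map_inj_in_uniq ?iota_uniq // => i j; rewrite !mem_iota /= => hi hj /eqP.
  rewrite nth_uniq ?s_size ?swapped_ltn // => /eqP h.
  by rewrite -(@swappedK _ e n4 (nth x0 s) i) h swappedK.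
Qed.

Hypothesis s_cheap : estimate e s * (n ^_ n)%:Z <= estimate e [::].

Lemma tour_cheap : (weight w (cycle_edges tour))%:~R < density w * n%:R - k%:R.
Proof.
have n4 : (3 < n)%N by lia.
have [n3 pu ps _] := tour_traverses.
apply/below_density/cheap_estimate; rewrite weight_traversal //.
rewrite (sum_traversal n3 pu ps x0).
move: s_cheap; rewrite (estimate_full _ n4 x0) //.
rewrite (eq_bigr (fun q : 'I_n => e (nth x0 tour q) (nth x0 tour (q.+1 %% n)))) //.
by move=> q _; rewrite !nth_tour ?ltn_mod ?cost_swapped //; try lia; exact: entryC.
Qed.

End GoodTour.

(** * The program *)

Section Terms.

Variable V : Type.

Definition t_add (a b : term V) := TOp Add a b.
Definition t_sub (a b : term V) := TOp Defs.Sub a b.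
Definition t_mul (a b : term V) := TOp Mul a b.
Definition t_div (a b : term V) := TOp Div a b.
Definition t_leq (a b : term V) := TOp Leq a b.
Definition t_size : term V := TRead 0 (TConst 0).

Definition t_lt (a b : term V) := t_leq (t_add a (TConst 1)) b.
Definition t_eq (a b : term V) := t_mul (t_leq a b) (t_leq b a).
Definition t_not (a : term V) := t_sub (TConst 1) a.
(** Selection by arithmetic, for c equal to 0 or 1; both branches are evaluated. *)
Definition t_if (c a b : term V) := t_add b (t_mul c (t_sub a b)).
Definition t_mod (a b : term V) := t_sub a (t_mul (t_div a b) b).
Definition t_abs (a : term V) := t_if (t_leq (TConst 0) a) a (t_sub (TConst 0) a).

Definition t_sum (f : V -> term V) : term V :=
  TFold 1 (TConst 0) (fun i acc => t_add (TVar acc) (f i)).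

(** The fold always makes n rounds; the factors beyond a are replaced by 1. *)
Definition t_fact (a : term V) : term V :=
  TFold 1 (TConst 1) (fun i acc =>
    t_mul (TVar acc) (t_if (t_lt (TVar i) a) (t_add (TVar i) (TConst 1)) (TConst 1))).

Definition t_entry (u v : term V) : term V := TRead 2 (t_add (t_mul u t_size) v).

Definition t_deviation (x y z u v : term V) : term V :=
  t_if (t_not (t_mul (t_not (t_eq u x)) (t_not (t_eq v x)))) (TConst 0)
    (t_add (t_sub (t_sub (t_entry u v) (t_entry x u)) (t_entry x v))
       (t_sub (t_add (t_entry x y) (t_entry x z)) (t_entry y z))).

Definition t_heaviness (x y z : term V) : term V :=
  t_sum (fun u => t_sum (fun v =>
    t_if (t_lt (TVar v) (TVar u)) (t_abs (t_deviation x y z (TVar u) (TVar v))) (TConst 0))).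

Definition t_first (a : term V) := t_div a (t_mul t_size t_size).
Definition t_second (a : term V) := t_mod (t_div a t_size) t_size.
Definition t_third (a : term V) := t_mod a t_size.

(** There are n^3 codes of triples, each tested with n^2 terms; the last light triple is kept. *)
Definition t_search : term V :=
  TFold 3 (TConst 0) (fun i acc =>
    let a := TVar i in
    t_if (t_leq (t_heaviness (t_first a) (t_second a) (t_third a))
            (t_mul (t_mul (TConst 4000) (TRead 1 (TConst 0))) t_size))
      (t_add a (TConst 1)) (TVar acc)).

Definition t_shift (x y z : term V) : term V :=
  let c := t_sub (t_add (t_entry x y) (t_entry x z)) (t_entry y z) in
  t_sub (t_sub (t_mul c t_size) (t_mul (TConst 2) c))
    (t_mul (TConst 2) (t_sum (fun v => t_entry x (TVar v)))).

Definition t_Delta (a b c d : term V) : term V :=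
  t_sub (t_sub (t_add (t_entry a b) (t_entry c d)) (t_entry a c)) (t_entry b d).

Definition t_block (q : term V) := t_mul (t_div q (TConst 3)) (TConst 3).
Definition t_pos (q : term V) (l : nat) : term V := t_mod (t_add (t_block q) (TConst l%:Z)) t_size.

Definition t_swaps (q a b c d : term V) : term V :=
  t_mul (t_leq (t_add (t_block q) (TConst 3)) t_size) (t_lt (TConst 0) (t_Delta a b c d)).

Definition t_cost (q a b c d : term V) : term V :=
  let s := t_swaps q a b c d in
  t_if (t_eq (t_mod q (TConst 3)) (TConst 0)) (t_entry a (t_if s c b))
    (t_if (t_eq (t_mod q (TConst 3)) (TConst 1)) (t_entry b c)
       (t_entry (t_if s b c) d)).

(* Array 6 holds the prefix chosen so far; [TRead 7 v] is one plus the position of [v] in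
   it, or 0 if [v] is not yet placed. *)
Definition t_unused (a : term V) : term V := t_eq (TRead 7 a) (TConst 0).

(** Compares one plus the position of a in the prefix extended by x with q + 1 if q is filled, and
    with 0 otherwise, which covers both cases of [fits]. *)
Definition t_fits (j x q a : term V) : term V :=
  t_eq (t_if (t_eq a x) (t_add j (TConst 1)) (TRead 7 a))
    (t_if (t_leq q j) (t_add q (TConst 1)) (TConst 0)).

Definition t_uniq (a b c d : term V) : term V :=
  t_mul (t_mul (t_mul (t_not (t_eq a b)) (t_not (t_eq a c))) (t_not (t_eq a d)))
    (t_mul (t_mul (t_not (t_eq b c)) (t_not (t_eq b d))) (t_not (t_eq c d))).

Definition t_free (j q : term V) : term V :=
  let f l := t_lt j (t_pos q l) in t_add (f 0%N) (t_add (f 1%N) (t_add (f 2%N) (f 3%N))).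

(** The factorial depends on the window alone and stands outside the sum over quadruples, so the
    time is of order n^5. *)
Definition t_estimate (j x : term V) : term V :=
  t_sum (fun q =>
    t_mul (t_fact (t_sub (t_sub t_size (t_add j (TConst 1))) (t_free j (TVar q))))
      (t_sum (fun a => t_sum (fun b => t_sum (fun c => t_sum (fun d =>
         let f l v := t_fits j x (t_pos (TVar q) l) (TVar v) in
         t_if (t_mul (t_uniq (TVar a) (TVar b) (TVar c) (TVar d))
                 (t_mul (f 0%N a) (t_mul (f 1%N b) (t_mul (f 2%N c) (f 3%N d)))))
           (t_cost (TVar q) (TVar a) (TVar b) (TVar c) (TVar d)) (TConst 0))))))).

(** The initial candidate 0 may already be placed, so an unplaced x also replaces any placed y. *)
Definition t_best (j : term V) : term V :=
  TFold 1 (TConst 0) (fun i acc =>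
    let x := TVar i in let y := TVar acc in
    t_if (t_mul (t_unused x)
            (t_not (t_mul (t_unused y)
                      (t_not (t_lt (t_estimate j x) (t_estimate j y))))))
      x y).

Definition t_swapped (q : term V) : term V :=
  let v l := TRead 6 (t_pos q l) in
  t_if (t_swaps q (v 0%N) (v 1%N) (v 2%N) (v 3%N))
    (t_if (t_eq (t_mod q (TConst 3)) (TConst 1)) (t_add q (TConst 1))
       (t_if (t_eq (t_mod q (TConst 3)) (TConst 2)) (t_sub q (TConst 1)) q)) q.

Definition s_reweight : stmt V :=
  let a := t_sub (TRead 8 (TConst 0)) (TConst 1) in
  let x := t_first a in let y := t_second a in let z := t_third a in
  SSeq (SSet 3 (TConst 0) (TConst 1))
    (SSeq (SSet 5 (TConst 0) (t_shift x y z))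
       (SFor 2 (fun i => let t := TVar i in
          SSet 4 t (t_deviation x y z (t_second t) (t_third t))))).

Definition s_greedy : stmt V :=
  SFor 1 (fun i => let j := TVar i in
    SSeq (SSet 6 j (t_best j)) (SSet 7 (TRead 6 j) (t_add j (TConst 1)))).

Definition s_output : stmt V :=
  SFor 1 (fun i => let q := TVar i in SSet 4 q (TRead 6 (t_swapped q))).

(* Cell 0 of array 8 is 0 if every [x, y, z] leaves a heavy deviation, and otherwise
   one plus the code [(x * n + y) * n + z] of a triple that does not. *)
Definition s_main : stmt V :=
  SSeq (SSet 8 (TConst 0) t_search)
    (SIf (TRead 8 (TConst 0)) s_reweight (SSeq s_greedy s_output)).

End Terms.

Lemma main_rel : exists c, stmt_rel [::] c 7 (s_main nat) (s_main int).
Proof.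
eexists; rewrite -[7%N]/(maxn 5 (maxn 1 (maxn 2 7))).
(* The rules synthesise the exponent, which is compared with 7 by computation afterwards. *)
have conv G c g g' s s' : g' = g -> stmt_rel G c g s s' -> stmt_rel G c g' s s' by move=> ->.
apply: conv; last first.
  repeat (intros; first [apply: rel_const | apply: rel_var; solve [repeat (first [by left | right])]
    | apply: rel_read; [by []|] | apply: rel_op | apply: rel_fold
    | apply: rel_set; [by []| |] | apply: rel_seq | apply: rel_if | apply: rel_for]).
by [].
Qed.

(** * Correctness of the program *)

Section Semantics.

Variables (n : nat) (w : weighting n) (A : memory).
Hypothesis n_large : (3 < n)%N.
Hypothesis A_size : A 0%N 0 = n%:Z.
Hypothesis A_weights : A 2%N =1 table w.

Local Notation ev := (teval n A).
Local Notation e := (entry w).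

Lemma teval_size : ev (t_size _) = n%:Z.
Proof. exact: A_size. Qed.

Lemma teval_leq a b : ev (t_leq a b) = (ev a <= ev b)%R%:R.
Proof. by rewrite /=; case: ifP. Qed.

Lemma teval_lt a b : ev (t_lt a b) = (ev a < ev b)%R%:R.
Proof. by rewrite teval_leq /= lezD1. Qed.

Lemma teval_and a b (p q : bool) : ev a = p%:R -> ev b = q%:R ->
  ev (t_mul a b) = (p && q)%:R.
Proof. by rewrite /= => -> ->; case: p; case: q. Qed.

Lemma teval_eq a b : ev (t_eq a b) = (ev a == ev b)%R%:R.
Proof. by rewrite (teval_and (teval_leq _ _) (teval_leq _ _)) -eq_le. Qed.

Lemma teval_not a (p : bool) : ev a = p%:R -> ev (t_not a) = (~~ p)%:R.
Proof. by rewrite /= => ->; case: p. Qed.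

Lemma teval_if c a b (p : bool) : ev c = p%:R ->
  ev (t_if c a b) = if p then ev a else ev b.
Proof. by rewrite /= => ->; case: p; rewrite ?mul0r ?mul1r ?addr0 // addrC subrK. Qed.

Lemma teval_add_nat a b i j : ev a = i%:Z -> ev b = j%:Z -> ev (t_add a b) = (i + j)%N%:Z.
Proof. by rewrite /= => -> ->. Qed.

Lemma teval_mul_nat a b i j : ev a = i%:Z -> ev b = j%:Z -> ev (t_mul a b) = (i * j)%N%:Z.
Proof. by rewrite /= => -> ->. Qed.

Lemma teval_div_nat a b i j : ev a = i%:Z -> ev b = j%:Z -> ev (t_div a b) = (i %/ j)%N%:Z.
Proof. by rewrite /= => -> ->; exact: divz_nat. Qed.

Lemma teval_mod_nat a b i j : ev a = i%:Z -> ev b = j%:Z -> ev (t_mod a b) = (i %% j)%N%:Z.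
Proof. by rewrite /= => -> ->; rewrite divz_nat -PoszM {1}(divn_eq i j) PoszD addrC addKr. Qed.

Lemma teval_abs a : ev (t_abs a) = `|ev a|.
Proof.
rewrite (teval_if _ _ (teval_leq _ _)) /= sub0r.
by case: leP => h; rewrite ?(ger0_norm h) ?(ltr0_norm h).
Qed.

Lemma teval_fold g a f F a0 : (forall i acc, ev (f i%:Z acc) = F i acc) ->
  ev a = a0 -> ev (TFold g a f) = iteri (n ^ g) F a0.
Proof. by move=> hF <-; exact: eq_iteri. Qed.

Lemma teval_sum f : ev (t_sum f) = \sum_(i < n) ev (f i%:Z).
Proof.
have h N : iteri N (fun i acc => acc + ev (f i%:Z)) 0 = \sum_(i < N) ev (f i%:Z).
  by elim: N => [|N IH]; rewrite ?big_ord0 // big_ord_recr /= IH.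
by rewrite (@teval_fold _ _ _ (fun i acc => acc + ev (f i%:Z)) 0) // expn1 h.
Qed.

(** A negative argument counts as 0, matching the truncated subtraction in [extensions]. *)
Lemma teval_fact a m : (m <= n)%N -> `|Num.max (ev a) 0|%N = m -> ev (t_fact a) = m`!%:Z.
Proof.
move=> mn hm.
pose F i (acc : int) := acc * (if (i < m)%N then i.+1%:Z else 1).
rewrite (@teval_fold _ _ _ F 1) // => [|i acc]; last first.
  transitivity (acc * ev (t_if (t_lt (TVar i%:Z) a) (t_add (TVar i%:Z) (TConst 1)) (TConst 1))) => //.
  rewrite (teval_if _ _ (teval_lt _ _)) /= /F.
  have -> : (i%:Z < ev a) = (i < m)%N by rewrite -hm; lia.
  by case: ifP => // _; rewrite -PoszD addn1.
have loop N : iteri N F 1 = (minn N m)`!%:Z.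
  elim: N => [|N IH] /=; first by rewrite min0n.
  rewrite IH /F; case: ltnP => h; last first.
    by rewrite mulr1; congr (_ `!)%N%:Z; lia.
  have -> : minn N.+1 m = N.+1 by lia.
  by rewrite factS mulnC PoszM.
by rewrite expn1 loop; congr (_ `!)%N%:Z; lia.
Qed.

Lemma table_entry (u v : 'I_n) : table w (u * n + v)%N%:Z = e u v.
Proof.
rewrite /table divnMDl ?(divn_small (ltn_ord v)) ?addn0; last by lia.
by rewrite modnMDl (modn_small (ltn_ord v)) (valK u) (valK v).
Qed.

Lemma teval_entry a b (u v : 'I_n) : ev a = (u : nat)%:Z -> ev b = (v : nat)%:Z ->
  ev (t_entry a b) = e u v.
Proof.
move=> ha hb; rewrite /t_entry /= -/(teval _ _ _) A_weights ha hb A_size -PoszM -PoszD.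
exact: table_entry.
Qed.

Lemma teval_eq_nat a b (i j : nat) : ev a = i%:Z -> ev b = j%:Z ->
  ev (t_eq a b) = (i == j)%:R.
Proof. by move=> ha hb; rewrite teval_eq ha hb eqz_nat. Qed.

Lemma teval_neq_ord a b (u v : 'I_n) : ev a = (u : nat)%:Z -> ev b = (v : nat)%:Z ->
  ev (t_not (t_eq a b)) = (u != v)%:R.
Proof. by move=> ha hb; rewrite (teval_not (teval_eq_nat ha hb)) val_eqE. Qed.

Lemma teval_deviation a b c d f (x y z u v : 'I_n) :
  ev a = (x : nat)%:Z -> ev b = (y : nat)%:Z -> ev c = (z : nat)%:Z ->
  ev d = (u : nat)%:Z -> ev f = (v : nat)%:Z ->
  ev (t_deviation a b c d f) = deviation e x y z u v.
Proof.
move=> ha hb hc hd hf.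
rewrite (teval_if _ _ (teval_not (teval_and (teval_neq_ord hd ha) (teval_neq_ord hf ha)))).
rewrite negb_and !negbK /deviation; case: ifP => // _.
rewrite -(teval_entry hd hf) -(teval_entry ha hd) -(teval_entry ha hf).
by rewrite -(teval_entry ha hb) -(teval_entry ha hc) -(teval_entry hb hc).
Qed.

Lemma teval_heaviness a b c (x y z : 'I_n) :
  ev a = (x : nat)%:Z -> ev b = (y : nat)%:Z -> ev c = (z : nat)%:Z ->
  ev (t_heaviness a b c) =
  \sum_(u < n) \sum_(v < n | (v < u)%N) `|deviation e x y z u v|.
Proof.
move=> ha hb hc; rewrite teval_sum; apply: eq_bigr => u _.
rewrite teval_sum [RHS]big_mkcond; apply: eq_bigr => v _; cbv beta.
rewrite (teval_if _ _ (teval_lt _ _)) ltz_nat; case: ifP => // _.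
by rewrite teval_abs (teval_deviation (u := u) (v := v) ha hb hc).
Qed.

Lemma teval_shift a b c (x y z : 'I_n) :
  ev a = (x : nat)%:Z -> ev b = (y : nat)%:Z -> ev c = (z : nat)%:Z ->
  ev (t_shift a b c) = shift w x y z.
Proof.
move=> ha hb hc; rewrite /shift -(teval_entry ha hb) -(teval_entry ha hc) -(teval_entry hb hc).
have -> : \sum_v e x v = ev (t_sum (fun v => t_entry a (TVar v))).
  by rewrite teval_sum; apply: eq_bigr => v _; rewrite (teval_entry (v := v) ha).
by rewrite -teval_size.
Qed.

Lemma teval_Delta ta tb tc td (a b c d : 'I_n) :
  ev ta = (a : nat)%:Z -> ev tb = (b : nat)%:Z -> ev tc = (c : nat)%:Z ->
  ev td = (d : nat)%:Z -> ev (t_Delta ta tb tc td) = Delta e a b c d.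
Proof.
move=> ha hb hc hd; rewrite /Delta.
by rewrite -(teval_entry ha hb) -(teval_entry hc hd) -(teval_entry ha hc) -(teval_entry hb hd).
Qed.

Lemma teval_block tq q : ev tq = q%:Z -> ev (t_block tq) = (q %/ 3 * 3)%N%:Z.
Proof. by move=> hq; apply: teval_mul_nat => //; apply: teval_div_nat. Qed.

Lemma teval_pos tq q l : ev tq = q%:Z -> ev (t_pos tq l) = (pos n q l)%:Z.
Proof.
move=> hq; apply: teval_mod_nat; last exact: teval_size.
by apply: teval_add_nat => //; apply: teval_block.
Qed.

Lemma teval_swaps tq ta tb tc td q (a b c d : 'I_n) : ev tq = q%:Z ->
  ev ta = (a : nat)%:Z -> ev tb = (b : nat)%:Z -> ev tc = (c : nat)%:Z ->
  ev td = (d : nat)%:Z -> ev (t_swaps tq ta tb tc td) = (swaps e q a b c d)%:R.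
Proof.
move=> hq ha hb hc hd; rewrite (teval_and (teval_leq _ _) (teval_lt _ _)).
rewrite (teval_Delta ha hb hc hd) teval_size.
by rewrite (@teval_add_nat _ (TConst 3) _ 3%N (teval_block hq) erefl).
Qed.

Lemma teval_cost tq ta tb tc td q (a b c d : 'I_n) : ev tq = q%:Z ->
  ev ta = (a : nat)%:Z -> ev tb = (b : nat)%:Z -> ev tc = (c : nat)%:Z ->
  ev td = (d : nat)%:Z -> ev (t_cost tq ta tb tc td) = cost e q a b c d.
Proof.
move=> hq ha hb hc hd; have hs := teval_swaps hq ha hb hc hd.
have hr : ev (t_mod tq (TConst 3)) = (q %% 3)%N%:Z by apply: teval_mod_nat.
have h0 := teval_eq_nat (b := TConst 0) (j := 0%N) hr erefl.
have h1 := teval_eq_nat (b := TConst 1) (j := 1%N) hr erefl.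
rewrite (teval_if _ _ h0) (teval_if _ _ h1) /cost.
case: eqP => _; last case: eqP => _.
- by apply: teval_entry => //; rewrite (teval_if _ _ hs); case: ifP.
- exact: teval_entry.
- by apply: teval_entry => //; rewrite (teval_if _ _ hs); case: ifP.
Qed.

Lemma teval_uniq ta tb tc td (a b c d : 'I_n) :
  ev ta = (a : nat)%:Z -> ev tb = (b : nat)%:Z -> ev tc = (c : nat)%:Z ->
  ev td = (d : nat)%:Z -> ev (t_uniq ta tb tc td) = (uniq [:: a; b; c; d])%:R.
Proof.
move=> ha hb hc hd.
rewrite (teval_and (teval_and (teval_and (teval_neq_ord ha hb) (teval_neq_ord ha hc))
  (teval_neq_ord ha hd)) (teval_and (teval_and (teval_neq_ord hb hc) (teval_neq_ord hb hd))
  (teval_neq_ord hc hd))).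
by rewrite /= !inE !negb_or !andbT !andbA.
Qed.

Section Prefix.

Variable s : seq 'I_n.
Hypotheses (s_uniq : uniq s) (s_short : (size s < n)%N).
Hypothesis A_prefix : forall v : 'I_n,
  A 7%N (v : nat)%:Z = if v \in s then (index v s).+1%:Z else 0.

Variable tj : term int.
Hypothesis tj_size : ev tj = (size s)%:Z.

Lemma teval_unused a (v : 'I_n) : ev a = (v : nat)%:Z ->
  ev (t_unused a) = (v \notin s)%:R.
Proof.
move=> ha; rewrite teval_eq /= -/(teval _ _ _) ha A_prefix.
by case: (v \in s).
Qed.

Lemma teval_fits tx tq ta (x a : 'I_n) q : x \notin s ->
  ev tx = (x : nat)%:Z -> ev tq = q%:Z -> ev ta = (a : nat)%:Z ->
  ev (t_fits tj tx tq ta) = (fits (rcons s x) q a)%:R.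
Proof.
move=> xs hx hq ha; rewrite teval_eq.
have hax := teval_eq_nat ha hx.
rewrite (teval_if _ _ hax) (teval_if _ _ (teval_leq _ _)) hq tj_size lez_nat.
rewrite (@teval_add_nat tj _ (size s) 1) // (@teval_add_nat tq _ q 1) // !addn1.
congr (nat_of_bool _)%:R.
have -> : ev (TRead 7 ta) = A 7%N (a : nat)%:Z by rewrite /= ha.
rewrite A_prefix /fits size_rcons ltnS nth_rcons mem_rcons inE val_eqE.
case: (eqVneq a x) => [->|ax] /=.
  case: (ssrnat.ltngtP q (size s)) => [h|h|->] /=; rewrite ?eqxx //.
    rewrite eqz_nat eqSS gtn_eqF //; apply/esym/negbTE/negP => /eqP h'.
    by case/negP: xs; rewrite -h' mem_nth.
case: (boolP (a \in s)) => has /=.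
  case: (ssrnat.ltngtP q (size s)) => [h|h|h] //=.
    rewrite eqz_nat eqSS; apply/eqP/eqP => [<-|<-]; first by rewrite nth_index.
    by rewrite index_uniq.
  by rewrite eqz_nat eqSS h (eq_sym x) (negbTE ax) ltn_eqF // index_mem.
case: (ssrnat.ltngtP q (size s)) => [h|h|h] //=; last by rewrite (eq_sym x) (negbTE ax).
by apply/esym/negbTE/negP => /eqP h'; case/negP: has; rewrite -h' mem_nth.
Qed.

Lemma teval_free tq q : ev tq = q%:Z ->
  ev (t_free tj tq) = (count (leq (size s).+1) (window n q))%:Z.
Proof.
move=> hq.
have f l : ev (t_lt tj (t_pos tq l)) = (size s < pos n q l)%N%:Z.
  by rewrite teval_lt tj_size (teval_pos _ hq) ltz_nat -natz.
by do 3!(apply: teval_add_nat => //); rewrite addn0.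
Qed.

Lemma teval_estimate tx (x : 'I_n) : x \notin s -> ev tx = (x : nat)%:Z ->
  ev (t_estimate tj tx) = estimate e (rcons s x).
Proof.
move=> xs hx; rewrite teval_sum; apply: eq_bigr => q _.
set m := (n - (size s).+1 - count (leq (size s).+1) (window n q))%N.
have hfact : ev (t_fact (t_sub (t_sub (t_size _) (t_add tj (TConst 1)))
    (t_free tj (TVar (q : nat)%:Z)))) = m`!%:Z.
  apply: teval_fact; first by rewrite /m; lia.
  have -> : ev (t_sub (t_sub (t_size _) (t_add tj (TConst 1))) (t_free tj (TVar (q : nat)%:Z))) =
     n%:Z - (size s).+1%:Z - (count (leq (size s).+1) (window n q))%:Z.
    rewrite -(@teval_free (TVar (q : nat)%:Z)) //.
    rewrite -[(size s).+1]addn1 PoszD -tj_size -teval_size //.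
  by rewrite /m; lia.
have -> a b : ev (t_mul a b) = ev a * ev b by [].
rewrite hfact /sum4 teval_sum mulr_sumr; apply: eq_bigr => a _.
rewrite teval_sum mulr_sumr; apply: eq_bigr => b _.
rewrite teval_sum mulr_sumr; apply: eq_bigr => c _.
rewrite teval_sum mulr_sumr; apply: eq_bigr => d _.
have hf l (v : 'I_n) : ev (t_fits tj tx (t_pos (TVar (q : nat)%:Z) l) (TVar (v : nat)%:Z)) =
    (fits (rcons s x) (pos n q l) v)%:R.
  by apply: teval_fits => //; apply: teval_pos.
have hu : ev (t_uniq (TVar (a : nat)%:Z) (TVar (b : nat)%:Z) (TVar (c : nat)%:Z)
    (TVar (d : nat)%:Z)) = (uniq [:: a; b; c; d])%:R by exact: teval_uniq.
rewrite (teval_if _ _ (teval_and hu (teval_and (hf _ a) (teval_and (hf _ b) (teval_and (hf _ c) (hf _ d)))))).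
rewrite (@teval_cost _ _ _ _ _ q a b c d) // /distinct /extensions.
case: (uniq [:: a; b; c; d]); rewrite ?mulr0 //= !andbT size_rcons -/m.
by case: ifP => _; rewrite ?mulr0 ?mul0r.
Qed.

End Prefix.

End Semantics.

(** The fold of [t_best] on natural numbers, with [U] marking the vertices already placed. *)
Definition argmin (U : pred nat) (c : nat -> int) (N : nat) : nat :=
  iteri N (fun i a => if ~~ U i && (U a || (c i < c a)) then i else a) 0%N.

Lemma argmin_ltn U c N : (0 < N)%N -> (argmin U c N < N)%N.
Proof.
elim: N => // -[_ _|N IH _]; first by rewrite /argmin /= if_same.
rewrite /argmin /= -/(argmin U c N.+1); case: ifP => // _.
exact: ltnW (IH isT).
Qed.

Lemma argminP U c N : (exists2 i, (i < N)%N & ~~ U i) ->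
  ~~ U (argmin U c N) /\ forall i, (i < N)%N -> ~~ U i -> c (argmin U c N) <= c i.
Proof.
elim: N => [[]//|N IH] [i hi Ui].
rewrite /argmin /= -/(argmin U c N); set a := argmin U c N.
have [hex|hall] := boolP (has (predC U) (iota 0 N)).
  have [k] := hasP hex; rewrite mem_iota /= => hk Uk.
  have [Ua ca] := IH (ex_intro2 _ _ k hk Uk).
  rewrite (negbTE Ua) orFb; case: ifP => [/andP[UN cN]|h]; split=> // l.
    rewrite ltnS leq_eqVlt => /orP[/eqP -> //|hl Ul].
    exact: le_trans (ltW cN) (ca l hl Ul).
  rewrite ltnS leq_eqVlt => /orP[/eqP -> Ul|]; last exact: ca.
  by move: h; rewrite Ul leNgt /= => ->.
(* No candidate occurs below N, so N is the first one and replaces the current value. *)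
have used l : (l < N)%N -> U l.
  by move=> hl; have /hasPn/(_ l) := hall; rewrite mem_iota negbK; apply.
have iN : i = N by apply/eqP; rewrite eqn_leq -ltnS hi leqNgt; apply: contra Ui => /used.
rewrite -iN Ui andTb.
have -> : (if U a || (c i < c a) then i else a) = i.
  case: (posnP N) => [N0|N_gt0]; last by rewrite used // argmin_ltn.
  by rewrite /a iN N0 /argmin /= if_same.
split=> // l; rewrite ltnS leq_eqVlt iN => /orP[/eqP -> //|/used ->] //.
Qed.

(** * The greedy choice and the search as evaluated by the program *)

Section Loops.

Variables (n k : nat) (w : weighting n) (x0 : 'I_n).
Hypothesis n_large : (3 < n)%N.

Local Notation e := (entry w).
Local Notation ord := (insubd x0).

Definition best (s : seq 'I_n) : 'I_n :=
  ord (argmin (fun i => ord i \in s) (fun i => estimate e (rcons s (ord i))) n).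

Lemma ordK i : (i < n)%N -> val (ord i) = i.
Proof. by move=> hi; rewrite val_insubd hi. Qed.

Lemma bestP s : uniq s -> (size s < n)%N -> best s \notin s /\
  forall y, y \notin s -> estimate e (rcons s (best s)) <= estimate e (rcons s y).
Proof.
move=> us hs; rewrite /best.
have [|hU hc] := @argminP (fun i => ord i \in s) (fun i => estimate e (rcons s (ord i))) n.
  have : (0 < #|[pred x | x \notin s]|)%N by rewrite card_notin_seq // subn_gt0.
  by case/card_gt0P => y ys; exists (val y); rewrite ?valKd ?(ltn_ord y).
by split=> // y ys; have := hc (val y) (ltn_ord y); rewrite valKd; apply.
Qed.

Section Read.

Variables (A : memory).
Hypothesis A_size : A 0%N 0 = n%:Z.
Hypothesis A_weights : A 2%N =1 table w.

Local Notation ev := (teval n A).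

Lemma teval_best s tj : uniq s -> (size s < n)%N ->
  (forall v : 'I_n, A 7%N (v : nat)%:Z = if v \in s then (index v s).+1%:Z else 0) ->
  ev tj = (size s)%:Z ->
  ev (t_best tj) = (best s : nat)%:Z.
Proof.
move=> us hs h7 hj.
pose U i := ord i \in s; pose c i := estimate e (rcons s (ord i)).
rewrite /best ordK; last by rewrite argmin_ltn; lia.
rewrite -/U -/c [LHS]/= expn1 -/(teval _ _ _).
set F := fun i acc => _.
have FE i a : (i < n)%N -> (a < n)%N ->
    F i a%:Z = (if ~~ U i && (U a || (c i < c a)) then i else a)%:Z.
  move=> hi ha; pose x : term int := TVar i%:Z; pose y : term int := TVar a%:Z.
  have hx : ev x = (ord i : nat)%:Z by rewrite ordK.
  have hy : ev y = (ord a : nat)%:Z by rewrite ordK.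
  transitivity (ev (t_if (t_mul (t_unused x) (t_not (t_mul (t_unused y)
                      (t_not (t_lt (t_estimate tj x) (t_estimate tj y)))))) x y)).
    by [].
  have ux := teval_unused h7 hx; have uy := teval_unused h7 hy.
  rewrite (teval_if _ _ (teval_and ux (teval_not (teval_and uy (teval_not (teval_lt _ _ _ _)))))).
  rewrite negb_and !negbK -/(U i) -/(U a).
  case: (boolP (U i)) => Ui; first by [].
  case: (boolP (U a)) => Ua; first by [].
  rewrite (teval_estimate n_large A_size A_weights us hs h7 hj Ui hx).
  rewrite (teval_estimate n_large A_size A_weights us hs h7 hj Ua hy).
  by rewrite -/(c i) -/(c a); case: ifP.
have loop N : (N <= n)%N -> iteri N F 0 = (argmin U c N)%:Z.
  elim: N => [//|N IH] hN /=; rewrite IH; last by lia.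
  rewrite FE //; case: (posnP N) => [->|N0]; first by rewrite /argmin /=; lia.
  exact: leq_trans (argmin_ltn _ _ N0) (ltnW hN).
exact: loop.
Qed.

Lemma teval_digits ti i : (i < n ^ 3)%N -> ev ti = i%:Z ->
  [/\ ev (t_first ti) = (ord (i %/ (n * n))%N : nat)%:Z,
      ev (t_second ti) = (ord (i %/ n %% n)%N : nat)%:Z &
      ev (t_third ti) = (ord (i %% n)%N : nat)%:Z].
Proof.
move=> hi hti.
have h1 : (i %/ (n * n) < n)%N.
  by rewrite ltn_divLR; [move: hi; rewrite !expnS expn0 muln1 | rewrite muln_gt0; lia].
have h2 : (i %/ n %% n < n)%N by rewrite ltn_mod; lia.
have h3 : (i %% n < n)%N by rewrite ltn_mod; lia.
rewrite !ordK //; split.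
- exact: teval_div_nat hti (teval_mul_nat (teval_size A_size) (teval_size A_size)).
- exact: teval_mod_nat (teval_div_nat hti (teval_size A_size)) (teval_size A_size).
- exact: teval_mod_nat hti (teval_size A_size).
Qed.

Lemma teval_swapped tq q v : ev tq = q%:Z ->
  (forall i, (i < n)%N -> A 6%N i%:Z = (v i : 'I_n)%N%:Z) ->
  ev (t_swapped tq) = (swapped e v q)%:Z.
Proof.
move=> hq h6.
have hv l : ev (TRead 6 (t_pos tq l)) = (v (pos n q l) : nat)%:Z.
  by rewrite -[LHS]/(A 6%N (ev (t_pos tq l))) (teval_pos A_size l hq) h6 // pos_ltn.
have hr : ev (t_mod tq (TConst 3)) = (q %% 3)%N%:Z by apply: teval_mod_nat.
have h1 := @teval_eq_nat _ A _ (TConst 1) _ 1%N hr erefl.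
have h2 := @teval_eq_nat _ A _ (TConst 2) _ 2%N hr erefl.
have hs := teval_swaps n_large A_size A_weights hq (hv 0%N) (hv 1%N) (hv 2%N) (hv 3%N).
rewrite (teval_if _ _ hs) (teval_if _ _ h1) (teval_if _ _ h2) /swapped.
case: ifP => // _; case: eqP => _; first by rewrite (@teval_add_nat _ _ _ _ q 1) // addn1.
case: eqP => h //; rewrite /= -/(teval _ _ _) hq.
have : (0 < q)%N by case: (q) h.
lia.
Qed.

Definition heaviness (x y z : 'I_n) : int :=
  \sum_(u < n) \sum_(v < n | (v < u)%N) `|deviation e x y z u v|.

Hypothesis A_k : A 1%N 0 = k%:Z.

Lemma teval_search :
  (ev (t_search _) = 0 /\ forall x y z, (4000 * k * n)%N%:Z < heaviness x y z) \/
  exists i, [/\ (i < n ^ 3)%N, ev (t_search _) = i.+1%:Z &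
    heaviness (ord (i %/ (n * n))%N) (ord (i %/ n %% n)%N) (ord (i %% n)%N) <= (4000 * k * n)%N%:Z].
Proof.
pose P i := heaviness (ord (i %/ (n * n))%N) (ord (i %/ n %% n)%N) (ord (i %% n)%N) <= (4000 * k * n)%N%:Z.
rewrite [ev _]/= -/(teval _ _ _).
set F := fun i acc => _.
have FE i acc : (i < n ^ 3)%N -> F i acc = if P i then i.+1%:Z else acc.
  move=> hi; have [h1 h2 h3] := @teval_digits (TVar i%:Z) i hi erefl.
  pose a : term int := TVar i%:Z.
  transitivity (ev (t_if (t_leq (t_heaviness (t_first a) (t_second a) (t_third a))
            (t_mul (t_mul (TConst 4000) (TRead 1 (TConst 0))) (t_size _)))
      (t_add a (TConst 1)) (TVar acc))); first by [].
  rewrite (teval_if _ _ (teval_leq _ _ _ _)) (teval_heaviness n_large A_size A_weights h1 h2 h3).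
  rewrite (@teval_mul_nat _ _ _ _ (4000 * k) n) ?(teval_size A_size) //.
    by rewrite (@teval_add_nat _ _ _ _ i 1) // addn1.
  by rewrite (@teval_mul_nat _ _ _ _ 4000 k).
have loop N : (N <= n ^ 3)%N ->
    (iteri N F 0 = 0 /\ forall i, (i < N)%N -> ~~ P i) \/
    exists i, [/\ (i < n ^ 3)%N, iteri N F 0 = i.+1%:Z & P i].
  elim: N => [|N IH] hN /=; first by left.
  rewrite FE //; case: ifP => hP; first by right; exists N.
  case: (IH (ltnW hN)) => [[-> h]|]; last by right.
  left; split=> // i; rewrite ltnS leq_eqVlt => /orP[/eqP ->|/h //]; by rewrite hP.
case: (loop _ (leqnn _)) => [[h0 hall]|]; [left | by right].
split=> // x y z; rewrite ltNge.
(* Every triple has a code below n^3, so a search that returns 0 has tested them all. *)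
pose i := ((x * n + y) * n + z)%N.
have lx := ltn_ord x; have ly := ltn_ord y; have lz := ltn_ord z.
have hi : (i < n ^ 3)%N by rewrite /i !expnS expn0 muln1; nia.
have := hall i hi; rewrite /P /i.
have -> : (((x * n + y) * n + z) %/ (n * n) = x)%N.
  by rewrite divnMA !divnMDl ?(divn_small lz) ?addn0 ?divnMDl ?(divn_small ly) ?addn0; lia.
have -> : (((x * n + y) * n + z) %/ n %% n = y)%N.
  by rewrite divnMDl ?(divn_small lz) ?addn0 ?modnMDl ?modn_small; lia.
by rewrite modnMDl (modn_small lz) !valKd.
Qed.

End Read.
End Loops.

(** The values written do not depend on array b, the only one that the loop changes, so no round
    disturbs a later one. *)
Lemma fill_array b (f : nat -> memory -> int) (g : nat -> int) N (B : memory) :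
  (forall i B', (i < N)%N -> (forall y j, y != b -> B' y j = B y j) -> f i B' = g i) ->
  let B' := iteri N (fun i B => update B b i%:Z (f i B)) B in
  (forall y j, y != b -> B' y j = B y j) /\ (forall i, (i < N)%N -> B' b i%:Z = g i).
Proof.
elim: N => [//|N IH] hf /=.
have [i B' hi|h1 h2] := IH; first by apply: hf; lia.
set B' := iteri _ _ _ in h1 h2 *; split=> [y j yb|i].
  by rewrite /update (negbTE yb) h1.
rewrite ltnS leq_eqVlt /update eqxx eqz_nat /= => /orP[/eqP ->|hi].
  by rewrite eqxx; apply: hf.
by rewrite (ltn_eqF hi) h2.
Qed.

(** * The two outputs of the program *)

Section Main.

Variables (n k : nat) (w : weighting n).
Hypothesis n_large : (5000 * (k + 1) < n)%N.

Let n4 : (3 < n)%N. Proof. lia. Qed.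
Variable x0 : 'I_n.

Variable A : memory.
Hypotheses (A_size : A 0%N 0 = n%:Z) (A_weights : A 2%N =1 table w).
Lemma output_reweighting i : (i < n ^ 3)%N -> A 8%N 0 = i.+1%:Z ->
  let x := insubd x0 (i %/ (n * n))%N in
  let y := insubd x0 (i %/ n %% n)%N in let z := insubd x0 (i %% n)%N in
  let m := srun n (s_reweight int) A in
  [/\ out_tag m = 1, outputs_weighting m (reweighting w x y z) &
      outputs_integer m (shift w x y z)].
Proof.
move=> hi hs x y z m.
pose A1 := update A 3 0 1.
pose A2 := update A1 5 0 (shift w x y z).
pose a : term int := t_sub (TRead 8 (TConst 0)) (TConst 1).
have ha B : B 8%N 0 = i.+1%:Z -> teval n B a = i%:Z by rewrite /= => ->; lia.
have digits B : B 0%N 0 = n%:Z -> B 8%N 0 = i.+1%:Z ->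
  [/\ teval n B (t_first a) = (x : nat)%:Z, teval n B (t_second a) = (y : nat)%:Z
    & teval n B (t_third a) = (z : nat)%:Z].
  by move=> h0 h8; apply: teval_digits => //; exact: ha.
pose f j B := teval n B (t_deviation (t_first a) (t_second a) (t_third a)
  (t_second (TVar j%:Z)) (t_third (TVar j%:Z))).
have mE : m = iteri (n ^ 2) (fun j B => update B 4 j%:Z (f j B)) A2.
  have [d1 d2 d3] := digits A1 A_size hs.
  by rewrite /A2 -(teval_shift n4 (A := A1) A_size A_weights d1 d2 d3).
pose g j := deviation (entry w) x y z (insubd x0 (j %/ n %% n)%N) (insubd x0 (j %% n)%N).
have hf j B : (j < n ^ 2)%N -> (forall y j, y != 4%N -> B y j = A2 y j) -> f j B = g j.
  move=> hj hB.
  have B0 : B 0%N 0 = n%:Z by rewrite hB.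
  have B2 : B 2%N =1 table w by move=> l; rewrite hB // /A2 /A1 /update /= A_weights.
  have B8 : B 8%N 0 = i.+1%:Z by rewrite hB.
  have [d1 d2 d3] := digits B B0 B8.
  have hj3 : (j < n ^ 3)%N by apply: leq_trans hj _; rewrite leq_pexp2l //; lia.
  have [_ d4 d5] := @teval_digits n x0 n4 B B0 (TVar j%:Z) j hj3 erefl.
  exact: (teval_deviation n4 B0 B2 d1 d2 d3 d4 d5).
have [h1 h2] := fill_array hf; rewrite -mE in h1 h2.
split.
- by rewrite /out_tag h1.
- move=> u v uv; have lu := ltn_ord u; have lv := ltn_ord v.
  rewrite h2; last by rewrite !expnS expn0 muln1; nia.
  rewrite entry_reweighting // /g divnMDl ?(divn_small lv) ?addn0; last by lia.
  by rewrite (modn_small lu) modnMDl (modn_small lv) !valKd.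
- by rewrite /outputs_integer h1.
Qed.

Hypotheses (A_unplaced : A 7%N =1 fun=> 0) (A_tag : A 3%N 0 = 0).

Local Notation best := (best w x0).

Definition prefix (j : nat) : seq 'I_n := iter j (fun s => rcons s (best s)) [::].

Lemma prefixP j : (j <= n)%N -> [/\ uniq (prefix j), size (prefix j) = j &
  estimate (entry w) (prefix j) * (n ^_ j)%:Z <= estimate (entry w) [::]].
Proof. apply: greedy => // s; exact: bestP. Qed.

Definition greedy_step (i : nat) (B : memory) : memory :=
  let B' := update B 6 i%:Z (teval n B (t_best (TVar i%:Z))) in
  update B' 7 (B' 6%N i%:Z) (i + 1)%N%:Z.

(** Loop invariant: array 7 stays the inverse of array 6, shifted by one so that the initial zeros
    mean unplaced. *)
Lemma greedy_steps j : (j <= n)%N ->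
  let B := iteri j greedy_step A in
  [/\ forall y i, (y < 6)%N -> B y i = A y i,
      forall i, (i < j)%N -> B 6%N i%:Z = (nth x0 (prefix j) i : nat)%:Z &
      forall v : 'I_n, B 7%N (v : nat)%:Z =
        if v \in prefix j then (index v (prefix j)).+1%:Z else 0].
Proof.
elim: j => [_|j IH hj] B; first by split.
have [h1 h2 h3] := IH (ltnW hj).
have [us hs _] := prefixP (ltnW hj).
have -> : B = greedy_step j (iteri j greedy_step A) by [].
move: (iteri j greedy_step A) h1 h2 h3 => {B}B h1 h2 h3.
have B_size : B 0%N 0 = n%:Z by rewrite h1.
have B_weights : B 2%N =1 table w by move=> a; rewrite h1.
have hb : teval n B (t_best (TVar j%:Z)) = (best (prefix j) : nat)%:Z.
  by apply: (teval_best x0 n4 B_size B_weights us) => //; rewrite hs.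
have bs : best (prefix j) \notin prefix j.
  by have [] := bestP w x0 us; rewrite ?hs.
rewrite /greedy_step hb addn1; set B1 := update B 6 _ _.
have e6 : B1 6%N j%:Z = (best (prefix j) : nat)%:Z by rewrite /B1 /update !eqxx.
rewrite e6 -[prefix j.+1]/(rcons (prefix j) (best (prefix j))).
split=> [y i hy|i|v].
- have [y7 y6] : (y == 7)%N = false /\ (y == 6)%N = false by lia.
  by rewrite /B1 /update y7 y6 h1.
- rewrite ltnS nth_rcons hs leq_eqVlt => /orP[/eqP ->|hi].
    by rewrite ltnn eqxx -e6.
  by rewrite hi -h2 // /B1 /update /= eqz_nat (ltn_eqF hi).
rewrite {1}/update eqxx eqz_nat val_eqE mem_rcons inE andTb.
case: eqP => [->|/eqP vb].
  by rewrite -cats1 index_cat (negbTE bs) /= eqxx addn0 hs.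
rewrite orFb /B1 /update /= h3; case: ifP => // vs.
by rewrite -cats1 index_cat vs.
Qed.

Lemma output_tour :
  let m := srun n (SSeq (s_greedy int) (s_output int)) A in
  out_tag m = 0 /\ outputs_cycle m (cycle_edges (tour w (prefix n) x0)).
Proof.
move=> m; have [us ss _] := prefixP (leqnn n).
have [h1 h2 _] := greedy_steps (leqnn n); set B := iteri n _ A in h1 h2.
pose f j B := teval n B (TRead 6 (t_swapped (TVar j%:Z))).
have mE : m = iteri n (fun j B => update B 4 j%:Z (f j B)) B.
  have -> : B = srun n (s_greedy int) A.
    rewrite /s_greedy -[RHS]/(iteri (n ^ 1) _ A) expn1; exact: eq_iteri.
  by rewrite -[LHS]/(iteri (n ^ 1) (fun j B => update B 4 j%:Z (f j B)) _) expn1.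
pose g j : int := (nth x0 (prefix n) (swapped (entry w) (nth x0 (prefix n)) j) : nat)%:Z.
have hf j B' : (j < n)%N -> (forall y j, y != 4%N -> B' y j = B y j) -> f j B' = g j.
  move=> hj hB.
  have B0 : B' 0%N 0 = n%:Z by rewrite hB // h1.
  have B2 : B' 2%N =1 table w by move=> l; rewrite hB // h1.
  have B6 i : (i < n)%N -> B' 6%N i%:Z = (nth x0 (prefix n) i : nat)%:Z.
    by move=> hi; rewrite hB // h2.
  rewrite /f -[LHS]/(B' 6%N (teval n B' (t_swapped (TVar j%:Z)))).
  by rewrite (@teval_swapped n w n4 B' B0 B2 (TVar j%:Z) j (nth x0 (prefix n))) // B6 // swapped_ltn.
have [h3 h4] := fill_array hf; rewrite -mE in h3 h4.
split; first by rewrite /out_tag h3 // h1.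
exists (tour w (prefix n) x0); first exact: (tour_traverses w n_large x0 us ss).
move=> i hi; rewrite h4 // (nth_map x0) ?nth_tour //.
by rewrite size_map size_iota.
Qed.

Lemma main_tour_cheap : (forall x y z, (4000 * k * n)%N%:Z < heaviness w x y z) ->
  (weight w (cycle_edges (tour w (prefix n) x0)))%:~R < density w * n%:R - k%:R.
Proof.
move=> h; have [us ss hE] := prefixP (leqnn n).
exact: (tour_cheap n_large h x0 us ss hE).
Qed.

End Main.

Lemma srun_main n (m : memory) : let A := update m 8 0 (teval n m (t_search _)) in
  srun n (s_main int) m =
  if teval n m (t_search _) != 0 then srun n (s_reweight int) A
  else srun n (SSeq (s_greedy int) (s_output int)) A.
Proof. by []. Qed.

Theorem theorem2 :
  exists (P : program) (C : nat),
  forall (n k : nat) (w : weighting n),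
    (5000 * (k + 1) < n)%N ->
    exists (t : nat) (m : memory),
      [/\ exec P (input k w) t m,
          (t <= C * n ^ 7)%N &
          (out_tag m = 0 /\
           exists H : subgraph n,
             [/\ hamilton_cycle H,
                 outputs_cycle m H &
                 (weight w H)%:~R < density w * n%:R - k%:R])
          \/
          (out_tag m = 1 /\
           exists (wstar : weighting n) (alpha : int),
             [/\ outputs_weighting m wstar,
                 outputs_integer m alpha,
                 (forall H : subgraph n, hamilton_cycle H ->
                    weight wstar H = weight w H + alpha) &
                 abs_weight wstar (complete n) <= (4000 * k * n)%N%:Z])].
Proof.
have [C rel] := main_rel; exists (scomp 0 (s_main nat)), C => n k w n_large.
have n4 : (3 < n)%N by lia.
have n0 : (0 < n)%N by lia.
have [t [m [ex ht [hm _]]]] := @scomp_correct n _ _ _ _ _ n0 rel 0 (input k w)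
  (input k w) erefl (fun _ _ _ => erefl) (fun _ _ => False_ind _).
exists t, m; split=> //.
have x0 : 'I_n := Ordinal n0.
have [[hs all_heavy]|[i [hi hs hheavy]]] :=
  @teval_search n k w x0 n4 (input k w) erefl (fun=> erefl) erefl.
  left; pose A := update (input k w) 8 0 0.
  (* The final memory is known on the arrays below [base], which include the output arrays 3, 4 and
     5. *)
  have {}hm : agree base m (srun n (SSeq (s_greedy int) (s_output int)) A).
    by move: hm; rewrite srun_main hs.
  have [hout hcycle] := output_tour (A := A) n_large x0 erefl (fun=> erefl) (fun=> erefl) erefl.
  split; first by rewrite /out_tag hm.
  exists (cycle_edges (tour w (prefix w x0 n) x0)); split.
  - by case: hcycle => p hp _; exists p.
  - case: hcycle => p hp hp4; exists p => // j hj; by rewrite hm // hp4.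
  - exact: main_tour_cheap.
right; pose A := update (input k w) 8 0 i.+1%:Z.
have {}hm : agree base m (srun n (s_reweight int) A) by move: hm; rewrite srun_main hs.
have [h1 h2 h3] := output_reweighting (A := A) (i := i) n_large x0 erefl (fun=> erefl) hi erefl.
split; first by rewrite /out_tag hm.
set x := insubd x0 (i %/ (n * n))%N in hheavy h2 h3.
set y := insubd x0 (i %/ n %% n)%N in hheavy h2 h3.
set z := insubd x0 (i %% n)%N in hheavy h2 h3.
exists (reweighting w x y z), (shift w x y z); split.
- by move=> u v uv; rewrite hm //; exact: h2.
- by rewrite /outputs_integer hm //; exact: h3.
- exact: reweighting_hamilton.
- by rewrite abs_weight_reweighting; exact: hheavy.
Qed.
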